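(* Let $R$ be a left and right noetherian ring and $n\geq 1$. Then $R_i(\mathrm{mod}\, R)=\Omega_i(\mathrm{mod}\, R)$ for every $1\leq i\leq n$ if and only if $R_i(\mathrm{mod}\, R)=\mathcal{T}_i(\mathrm{mod}\, R)$ for every $1\leq i\leq n$; and in this case $R$ is $G_n(1)^{op}$.
   Context: $\mathrm{mod}\,R$ is the category of finitely generated left $R$-modules. For a module $M$, $0\to M\to I_0(M)\to I_1(M)\to\cdots$ denotes its minimal injective resolution; $I_j(R)$ refers to $R$ as a left $R$-module; $\mathrm{fd}$ is flat dimension. For $i\geq 1$: $R_i(\mathrm{mod}\,R)$ is the class of $M\in\mathrm{mod}\,R$ such that for every $0\leq l\leq i-1$, $I_l(M)$ is isomorphic to a direct summand of a direct sum of copies of $\bigoplus_{j\leq l}I_j(R)$. $\Omega_i(\mathrm{mod}\,R)$ is the class of $i$-syzygy modules, i.e. $M\in\mathrm{mod}\,R$ for which there is an exact sequence $0\to M\to P_{i-1}\to\cdots\to P_0\to A\to 0$ in $\mathrm{mod}\,R$ with every $P_j$ projective. $\mathcal T_i(\mathrm{mod}\,R)$ is the class of $i$-torsionfree modules, i.e. $M\in\mathrm{mod}\,R$ with $\mathrm{Ext}^j_{R^{op}}(\mathrm{Tr}\,M,R)=0$ for all $1\leq j\leq i$, where $\mathrm{Tr}\,M$ is the Auslander transpose. $R$ is $G_n(k)^{op}$ if $\mathrm{fd}\,I_i(R)\leq i+k$ for every $0\leq i\leq n-1$. *)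

(* Defs.v *)
From HB Require Import structures.
From mathcomp Require Import all_boot all_order all_algebra.
From mathcomp Require Import boolp classical_sets functions cardinality.
From mathcomp Require Import freeg.

Set Implicit Arguments.
Unset Strict Implicit.
Unset Printing Implicit Defensive.

Import GRing.Theory.
Local Open Scope ring_scope.
Local Open Scope quotient_scope.

(* Left R-modules are [lmodType R], right R-modules are [lmodType R^c]; the   *)
(* ring R as a left (resp. right) module over itself is R^o (resp. R^c^o).    *)

Section Modules.
Variable R : pzRingType.
Implicit Types A B C M N P E : lmodType R.

Definition iso M N := exists f : {linear M -> N}, bijective f.

Definition onto (S T : Type) (f : S -> T) := forall y, exists x, f x = y.

Definition exact A B C (f : {linear A -> B}) (g : {linear B -> C}) :=
  forall y, g y = 0 <-> exists x, f x = y.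

Definition lin_comb M (s : seq M) (x : M) :=
  exists c : 'I_(size s) -> R, x = \sum_(i < size s) c i *: s`_i.

Definition fin_gen M := exists s : seq M, forall x, lin_comb s x.

(* A left ideal of R is a submodule of R^o. *)
Definition left_noetherian :=
  forall I : submodClosed R^o,
    exists s : seq R^o, forall x, x \in I <-> lin_comb s x.

Definition projective P :=
  forall A B (g : {linear A -> B}) (f : {linear P -> B}), onto g ->
    exists h : {linear P -> A}, forall x, g (h x) = f x.

Definition injective_mod E :=
  forall A B (f : {linear A -> B}) (g : {linear A -> E}), injective f ->
    exists h : {linear B -> E}, forall x, h (f x) = g x.

(* The image of f meets every nonzero submodule of B nontrivially. *)
Definition essential A B (f : {linear A -> B}) :=
  forall U : submodClosed B,
    (forall x, f x \in U -> f x = 0) -> forall y, y \in U -> y = 0.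

(* Minimality: each term is an injective envelope of the preceding cokernel,  *)
(* i.e. an essential extension of the image of the incoming map.              *)
Record min_inj_resolution M := MinInjResolution {
  ir_obj :> nat -> lmodType R;
  ir_aug : {linear M -> ir_obj 0};
  ir_d : forall k, {linear ir_obj k -> ir_obj k.+1};
  ir_aug_inj : injective ir_aug;
  ir_exact0 : exact ir_aug (ir_d 0);
  ir_exact : forall k, exact (ir_d k) (ir_d k.+1);
  ir_injective : forall k, injective_mod (ir_obj k);
  ir_min0 : essential ir_aug;
  ir_min : forall k, essential (ir_d k)
}.

Record resolution (Q : lmodType R -> Prop) M := Resolution {
  res_obj :> nat -> lmodType R;
  res_d : forall k, {linear res_obj k.+1 -> res_obj k};
  res_aug : {linear res_obj 0 -> M};
  res_aug_onto : onto res_aug;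
  res_exact0 : exact (res_d 0) res_aug;
  res_exact : forall k, exact (res_d k.+1) (res_d k);
  res_class : forall k, Q (res_obj k)
}.

(* Ext^j_R(M, N) = 0: the complex Hom_R(P, N) is exact in degree j, for P a   *)
(* projective resolution of M (the choice of P is immaterial).                *)
Definition Ext_eq0 (j : nat) M N :=
  exists P : resolution projective M,
    forall phi : {linear P j -> N}, (forall x, phi (res_d P j x) = 0) ->
      match j return {linear P j -> N} -> Prop with
      | 0 => fun phi => forall x, phi x = 0
      | m.+1 => fun phi =>
          exists psi : {linear P m -> N}, forall x, phi x = psi (res_d P m x)
      end phi.

Definition isom_to_summand M N := exists M', iso (M * M')%type N.

(* The direct sum of copies of M indexed by X: finitely supported families.   *)
Definition finsupp (X : Type) M : {pred X -> M} :=
  fun f => `[< finite_set [set x | f x != 0] >].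

Lemma finsupp_submod (X : Type) M : submod_closed (@finsupp X M).
Proof.
split=> [|a f g /asboolP Ff /asboolP Fg]; apply/asboolP.
  by apply: (sub_finite_set (B := set0)) => // x /=; rewrite eqxx.
apply: (sub_finite_set (B := [set x | f x != 0] `|` [set x | g x != 0])%classic).
  move=> x /= nz; have [fx0|] := eqVneq (f x) 0; last by left.
  right; apply: contra nz => /eqP gx0.
  by rewrite /GRing.add /= /GRing.scale /= fx0 gx0 scaler0 addr0.
by rewrite finite_setU.
Qed.

HB.instance Definition _ (X : Type) M :=
  GRing.isSubmodClosed.Build R (X -> M) (@finsupp X M) (@finsupp_submod X M).

Record copies (X : Type) M :=
  Copies { copies_val :> X -> M; _ : copies_val \in @finsupp X M }.

HB.instance Definition _ X M := [isSub for @copies_val X M].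
HB.instance Definition _ X M := [Choice of copies X M by <:].
HB.instance Definition _ X M := [SubChoice_isSubLmodule of copies X M by <:].

(* I_0 (+) ... (+) I_l *)
Fixpoint dsum_le (I : nat -> lmodType R) (l : nat) : lmodType R :=
  if l is l'.+1 then (dsum_le I l' * I l)%type else I 0%N.

End Modules.

Section Tensor.
Variables (R : pzRingType) (A : lmodType R^c) (M : lmodType R).

Local Notation free := {freeg (A * M)%type / int}.

Inductive tensor_rel : free -> Prop :=
| tensor_rel_Dl a b x :
    tensor_rel (<< (a + b, x) >> - << (a, x) >> - << (b, x) >>)
| tensor_rel_Dr a x y :
    tensor_rel (<< (a, x + y) >> - << (a, x) >> - << (a, y) >>)
| tensor_rel_bal (r : R) a x :
    tensor_rel (<< ((r : R^c) *: a, x) >> - << (a, r *: x) >>)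
| tensor_rel_0 : tensor_rel 0
| tensor_rel_B u v : tensor_rel u -> tensor_rel v -> tensor_rel (u - v).

Definition tensor_ker : {pred free} := fun u => `[< tensor_rel u >].

Lemma tensor_ker_zmod : zmod_closed tensor_ker.
Proof.
split=> [|u v /asboolP ru /asboolP rv]; apply/asboolP.
  exact: tensor_rel_0.
exact: tensor_rel_B.
Qed.

HB.instance Definition _ :=
  GRing.isZmodClosed.Build free tensor_ker tensor_ker_zmod.

Definition tensor : zmodType := Quotient.quot tensor_ker.

Definition pure_tensor (a : A) (x : M) : tensor :=
  \pi_(Quotient.quot tensor_ker) << (a, x) >>.

End Tensor.

Section Flat.
Variable R : pzRingType.
Implicit Types M F : lmodType R.

(* f (x) F : A (x)_R F -> B (x)_R F is the additive map g below, which is     *)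
(* determined by f as pure tensors generate A (x)_R F.                        *)
Definition flat F :=
  forall (A B : lmodType R^c) (f : {linear A -> B}), injective f ->
    exists2 g : {additive tensor A F -> tensor B F},
      forall a x, g (pure_tensor a x) = pure_tensor (f a) x & injective g.

Definition fd_le M (m : nat) :=
  exists F : resolution flat M, forall k, (m < k)%N -> forall x : F k, x = 0.

End Flat.

Section Transpose.
Variable R : pzRingType.
Implicit Types M P : lmodType R.

(* Hom_R(M, R) with its right R-module structure (f . a) x = f x * a.         *)
Definition is_form M : {pred M -> R^c^o} :=
  fun f => `[< @GRing.linear_for R M R^o *:%R f >].

Lemma is_form_submod M : submod_closed (@is_form M).
Proof.
split=> [|a f g /asboolP Lf /asboolP Lg]; apply/asboolP => b x y.
  by change (0 = b * 0 + 0 :> R); rewrite mulr0 addr0.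
have {}Lf : f (b *: x + y) = b * (f x : R) + f y :> R by exact: Lf.
have {}Lg : g (b *: x + y) = b * (g x : R) + g y :> R by exact: Lg.
change ((f (b *: x + y) : R) * (a : R) + g (b *: x + y) =
  b * ((f x : R) * (a : R) + g x) + ((f y : R) * (a : R) + g y) :> R).
by rewrite Lf Lg mulrDl mulrDr mulrA addrACA.
Qed.

HB.instance Definition _ M :=
  GRing.isSubmodClosed.Build R^c (M -> R^c^o) (@is_form M) (@is_form_submod M).

Record dual M := Dual { dual_val :> M -> R^c^o; _ : dual_val \in @is_form M }.

HB.instance Definition _ M := [isSub for @dual_val M].
HB.instance Definition _ M := [Choice of dual M by <:].
HB.instance Definition _ M := [SubChoice_isSubLmodule of dual M by <:].

Section DualMap.
Variables (M N : lmodType R) (f : {linear M -> N}).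

Lemma dual_map_subproof (u : dual N) : (fun x => u (f x)) \in @is_form M.
Proof.
by apply/asboolP=> a x y; rewrite linearP; case: u => u /= /asboolP ->.
Qed.

Definition dual_map (u : dual N) : dual M := Dual (dual_map_subproof u).

Lemma dual_map_linear : linear dual_map.
Proof. by move=> a u v; apply/val_inj. Qed.

HB.instance Definition _ :=
  GRing.isLinear.Build R^c (dual N) (dual M) _ dual_map dual_map_linear.
End DualMap.

(* T is a transpose of M: the cokernel of P0^* -> P1^* for some presentation  *)
(* P1 -> P0 -> M -> 0 by finitely generated projectives. Such a T is unique   *)
(* up to projective direct summands.                                          *)
Definition is_transpose M (T : lmodType R^c) :=
  exists (P1 P0 : lmodType R) (f : {linear P1 -> P0}) (e : {linear P0 -> M}),
    [/\ fin_gen P1 /\ projective P1, fin_gen P0 /\ projective P0,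
        onto e /\ exact f e &
        exists q : {linear dual P1 -> T}, onto q /\ exact (dual_map f) q].

End Transpose.

Section Classes.
Variable R : pzRingType.
Implicit Types M : lmodType R.

Definition class_R (i : nat) M :=
  fin_gen M /\
  exists (I : min_inj_resolution M) (J : min_inj_resolution R^o),
    forall l, (l < i)%N ->
      exists X : Type, isom_to_summand (I l) (copies X (dsum_le J l)).

(* 0 -> M -> X 1 -> ... -> X i -> X i.+1 -> 0, with P_(i - k) = X k for       *)
(* 1 <= k <= i, A = X i.+1, and M identified with X 0.                        *)
Definition class_Omega (i : nat) M :=
  fin_gen M /\
  exists (X : nat -> lmodType R) (d : forall k, {linear X k -> X k.+1}),
    [/\ iso M (X 0%N),
        injective (d 0%N),
        forall k, (k < i)%N -> exact (d k) (d k.+1),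
        onto (d i) &
        (forall k, (1 <= k <= i)%N -> fin_gen (X k) /\ projective (X k)) /\
        fin_gen (X i.+1)].

Definition class_T (i : nat) M :=
  fin_gen M /\
  exists2 T : lmodType R^c, is_transpose M T &
    forall j, (1 <= j <= i)%N -> Ext_eq0 j T R^c^o.

End Classes.

Definition Gop (R : pzRingType) (n k : nat) :=
  exists J : min_inj_resolution (R^o : lmodType R),
    forall i, (i < n)%N -> fd_le (J i) (i + k).

(* Main.v *)
Require Import Defs.
From HB Require Import structures.
From mathcomp Require Import all_boot all_order all_algebra.
From mathcomp Require Import boolp classical_sets functions cardinality.

Set Implicit Arguments.
Unset Strict Implicit.
Unset Printing Implicit Defensive.

Import GRing.Theory.
Local Open Scope ring_scope.
Local Open Scope quotient_scope.

(** Write J for the minimal injective resolution of R, and call a short exact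
    sequence 0 -> M -> P -> N -> 0, with P finitely generated projective, a left
    approximation of M if every linear form on M extends to P. Two comparisons
    hold for every i, and they already give one of the two implications:
    T_i is contained in Omega_i, and Omega_i in R_i.

    - M is i-torsionfree exactly when it has i successive left approximations
      ([class_TP]). Indeed, if N is the cokernel of a left approximation of M,
      then the first syzygy of Tr M is a transpose of N, while
      Ext^1(Tr M, R) = 0 says that M embeds in its left approximation
      ([transpose_step]). Forgetting the extension of forms leaves an i-th
      syzygy.
    - The classes R_i do not require minimality: a finitely generated M lies in
      R_i as soon as some injective resolution of M has its first terms in
      Add(J_0), Add(J_0 + J_1), ... ([class_RP]), because the minimal resolution
      is a termwise summand of any other. In this form R_i is closed under
      extensions ([copresented_ext]), and the kernel of P -> N lies in R_(i+1)
      when P does and N lies in R_i ([copresented_ker]); hence every i-th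
      syzygy is in R_i ([syz_copresented]).

    Suppose now that R_i = Omega_i for i <= n. To see that R_i is contained in
    T_i, take M in R_(i+1) = Omega_(i+1), a syzygy sequence 0 -> M -> Q -> A -> 0
    with A in Omega_i, and a left approximation 0 -> M -> L -> N -> 0. Extending
    M -> Q to L gives an exact sequence 0 -> L -> N + Q -> A -> 0. As L and A are
    in R_i so is N + Q, hence so is N, and by induction N is i-torsionfree, so
    that M is (i+1)-torsionfree ([copresented_torsionfree]).

    For the flat dimension of J_m, with m < n, let K be its m-th syzygy. Two
    facts are moved from J_m to K, one syzygy at a time. First, every finite
    subset of J_m generates a module whose injective envelope is a summand of
    J_m; so every finite subset of K lies in a finitely generated submodule
    belonging to R_(m+1) = T_(m+1) ([loc_copresented_syz]). Second, a map from a
    torsionless module to the injective J_m factors through a projective; so a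
    map from an (m+1)-torsionfree module to K does ([torsionfree_factors_syz]).
    Hence every finite subset of K lies in a finitely generated submodule whose
    inclusion factors through a projective, and such a K is flat ([flat_local]).
    This gives fd J_m <= m, and in particular G_n(1)^op. *)

Arguments res_exact {R Q M} r k y.
Arguments res_exact0 {R Q M} r y.
Arguments ir_exact {R M} m k y.

(** * Submodules and quotient modules *)

Section Basics.
Variable R : pzRingType.
Implicit Types A B C M N : lmodType R.

Lemma linear_exists M N (f : M -> N) : linear f -> exists g : {linear M -> N}, g =1 f.
Proof.
move=> lf; pose F : {linear M -> N} :=
  HB.pack_for {linear M -> N} f (GRing.isLinear.Build R M N _ f lf).
by exists F.
Qed.

(** Propositional, so that submodules can be given by existential formulas. *)
Definition submodule M (S : M -> Prop) :=
  S 0 /\ forall a x y, S x -> S y -> S (a *: x + y).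

Lemma submodule_closed M (S : M -> Prop) : submodule S ->
  exists U : submodClosed M, forall x, x \in U <-> S x.
Proof.
move=> [S0 SZ]; pose U : {pred M} := fun x => `[< S x >].
have cU : submod_closed U.
  by split=> [|a x y /asboolP Sx /asboolP Sy]; apply/asboolP => //; exact: SZ.
pose V : submodClosed M :=
  HB.pack_for (submodClosed M) U (GRing.isSubmodClosed.Build R M U cU).
by exists V => x; split=> [/asboolP|Sx] //; apply/asboolP.
Qed.

Section SubType.
Variables (M : lmodType R) (U : submodClosed M).
Record sub_module := SubModule { sub_module_val :> M; _ : sub_module_val \in U }.
HB.instance Definition _ := [isSub for sub_module_val].
HB.instance Definition _ := [Choice of sub_module by <:].
HB.instance Definition _ := [SubChoice_isSubLmodule of sub_module by <:].
End SubType.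

Lemma submodule_exists M (S : M -> Prop) : submodule S ->
  exists (K : lmodType R) (i : {linear K -> M}),
    injective i /\ forall x, S x <-> exists y, i y = x.
Proof.
move=> /submodule_closed[U US].
have [i iE] := @linear_exists (sub_module U) M val (fun a x y => erefl).
exists (sub_module U), i; split=> [x y|x]; first by rewrite !iE => /val_inj.
split=> [/US Ux|[y <-]]; first by exists (SubModule Ux); rewrite iE.
by rewrite iE; apply/US; case: y.
Qed.

Section Quot.
Variables (M : lmodType R) (S : M -> Prop) (sS : submodule S).
Definition submodule_pred of submodule S : {pred M} := fun x => `[< S x >].
Lemma submodule_pred_zmod : zmod_closed (submodule_pred sS).
Proof.
split=> [|x y /asboolP Sx /asboolP Sy]; apply/asboolP; first exact: sS.1.
by rewrite addrC -scaleN1r; exact: sS.2.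
Qed.
HB.instance Definition _ := GRing.isZmodClosed.Build M (submodule_pred sS) submodule_pred_zmod.
Definition quot_module : Type := Quotient.quot (submodule_pred sS).
HB.instance Definition _ := GRing.Zmodule.on quot_module.
Definition quot_pi : M -> quot_module := \pi_(Quotient.quot (submodule_pred sS)).

Lemma quot_piB x y : quot_pi (x - y) = quot_pi x - quot_pi y.
Proof. exact: (raddfB (\pi_(Quotient.quot (submodule_pred sS)))). Qed.
Lemma quot_pi_eq x y : quot_pi x = quot_pi y <-> S (x - y).
Proof.
have := Quotient.idealrBE (submodule_pred sS) x y.
move=> E; split=> [e|Sxy].
  by apply/asboolP; change (x - y \in submodule_pred sS); rewrite E; apply/eqP.
by apply/eqP; rewrite /quot_pi -E; apply/asboolP.
Qed.
Definition quot_scale (a : R) (x : quot_module) : quot_module :=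
  quot_pi (a *: repr (x : Quotient.quot (submodule_pred sS))).
Lemma quot_reprK (x : quot_module) : quot_pi (repr (x : Quotient.quot (submodule_pred sS))) = x.
Proof. exact: reprK. Qed.
Lemma quot_scale_pi a x : quot_scale a (quot_pi x) = quot_pi (a *: x).
Proof.
apply/quot_pi_eq; rewrite -scalerBr -[X in S X]addr0; apply: sS.2 sS.1.
by apply/quot_pi_eq; rewrite quot_reprK.
Qed.
Lemma quot_pi_onto x : exists y, quot_pi y = x.
Proof. by exists (repr (x : Quotient.quot (submodule_pred sS))); exact: quot_reprK. Qed.
Lemma quot_piD x y : quot_pi (x + y) = quot_pi x + quot_pi y.
Proof. exact: (raddfD (\pi_(Quotient.quot (submodule_pred sS)))). Qed.

Lemma quot_scaleA a b x : quot_scale a (quot_scale b x) = quot_scale (a * b) x.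
Proof. by have [y <-] := quot_pi_onto x; rewrite !quot_scale_pi scalerA. Qed.
Lemma quot_scale1 : left_id 1 quot_scale.
Proof. by move=> x; have [y <-] := quot_pi_onto x; rewrite !quot_scale_pi scale1r. Qed.
Lemma quot_scaleDr : right_distributive quot_scale +%R.
Proof.
move=> a x y; have [x' <-] := quot_pi_onto x; have [y' <-] := quot_pi_onto y.
by rewrite -quot_piD !quot_scale_pi -quot_piD scalerDr.
Qed.
Lemma quot_scaleDl x : {morph quot_scale^~ x : a b / a + b}.
Proof.
move=> a b; have [x' <-] := quot_pi_onto x.
by rewrite !quot_scale_pi scalerDl quot_piD.
Qed.
HB.instance Definition _ :=
  GRing.Zmodule_isLmodule.Build R quot_module quot_scaleA quot_scale1 quot_scaleDr quot_scaleDl.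
End Quot.

(** Quotients and submodules are only used through their maps, so that they are
    stated as existence results hiding the underlying carriers. *)
Lemma quotient_exists M (S : M -> Prop) : submodule S ->
  exists (C : lmodType R) (p : {linear M -> C}), onto p /\ forall x, p x = 0 <-> S x.
Proof.
move=> sS; have [|p pE] := @linear_exists M (quot_module sS) (@quot_pi M S sS).
  by move=> a x y; rewrite quot_piD -quot_scale_pi.
exists (quot_module sS), p; split=> [x|x].
  by have [y <-] := quot_pi_onto x; exists y; rewrite pE.
rewrite pE -{2}(subr0 x) -(quot_pi_eq sS).
suff -> : quot_pi sS 0 = 0 by [].
by rewrite -(subr0 0) quot_piB subrr.
Qed.
End Basics.

(** * Linear maps, exact sequences and finite generation *)

Section Maps.
Variable R : pzRingType.
Implicit Types A B C M N : lmodType R.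

Definition lcomp A B C (g : {linear B -> C}) (f : {linear A -> B}) : {linear A -> C} := g \o f.
Definition lid A : {linear A -> A} := idfun.
Definition lzero A B : {linear A -> B} := \0.
Definition ladd A B (f g : {linear A -> B}) : {linear A -> B} := f \+ g.
Definition lsub A B (f g : {linear A -> B}) : {linear A -> B} := f \- g.

Definition lfst A B : {linear (A * B)%type -> A} := fst.
Definition lsnd A B : {linear (A * B)%type -> B} := snd.

Definition lpairf A B C (f : C -> A) (g : C -> B) (x : C) : (A * B)%type := (f x, g x).
Lemma lpair_linear A B C (f : {linear C -> A}) (g : {linear C -> B}) :
  linear (lpairf f g).
Proof. by move=> a x y; rewrite /lpairf !linearP. Qed.
HB.instance Definition _ A B C (f : {linear C -> A}) (g : {linear C -> B}) :=
  GRing.isLinear.Build R C (A * B)%type _ (lpairf f g) (lpair_linear f g).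
Definition lpair A B C (f : {linear C -> A}) (g : {linear C -> B}) :
  {linear C -> (A * B)%type} := lpairf f g.
Definition linl A B := lpair (lid A) (lzero A B).
Definition linr A B := lpair (lzero B A) (lid B).

Lemma linear_injective A B (f : {linear A -> B}) :
  (forall x, f x = 0 -> x = 0) -> injective f.
Proof. by move=> f0 x y e; apply/subr0_eq/f0; rewrite linearB e /= subrr. Qed.

Lemma injective_eq0 A B (f : {linear A -> B}) x : injective f -> f x = 0 -> x = 0.
Proof. by move=> fi e; apply: fi; rewrite e linear0. Qed.

Lemma lift_through_inj A B C (i : {linear A -> B}) (g : {linear C -> B}) :
  injective i -> (forall x, exists y, i y = g x) ->
  exists h : {linear C -> A}, forall x, i (h x) = g x.
Proof.
move=> ii /choice[h hE]; have [|h' h'E] := @linear_exists _ _ _ h.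
  by move=> a x y; apply: ii; rewrite hE !linearP !hE.
by exists h' => x; rewrite h'E.
Qed.

Lemma factor_through_onto A B C (p : {linear A -> B}) (g : {linear A -> C}) :
  onto p -> (forall x, p x = 0 -> g x = 0) ->
  exists h : {linear B -> C}, forall x, h (p x) = g x.
Proof.
move=> po pg; have [s sE] := choice po.
have gs x : g (s (p x)) = g x.
  by apply/subr0_eq; rewrite -linearB; apply: pg; rewrite linearB /= sE subrr.
have [|h hE] := @linear_exists _ _ _ (g \o s).
  move=> a x y /=; rewrite -linearP; apply/subr0_eq; rewrite -linearB.
  by apply: pg; rewrite linearB linearP /= !sE subrr.
by exists h => x; rewrite hE /= gs.
Qed.

Lemma kernel_exists A B (f : {linear A -> B}) :
  exists (K : lmodType R) (i : {linear K -> A}), injective i /\ exact i f.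
Proof.
have [|K [i [ii iE]]] := @submodule_exists _ A (fun x => f x = 0).
  by split=> [|a x y fx fy]; rewrite ?linear0 // linearP fx fy scaler0 addr0.
by exists K, i.
Qed.

Definition range_of A B (f : A -> B) y := exists x, f x = y.
Lemma submodule_range A B (f : {linear A -> B}) : submodule (range_of f).
Proof.
split=> [|a x y [u <-] [v <-]]; first by exists 0; rewrite linear0.
by exists (a *: u + v); rewrite linearP.
Qed.

Lemma cokernel_exists A B (f : {linear A -> B}) :
  exists (C : lmodType R) (p : {linear B -> C}), onto p /\ exact f p.
Proof. exact: quotient_exists (submodule_range f). Qed.

Lemma image_exists A B (f : {linear A -> B}) :
  exists (M : lmodType R) (p : {linear A -> M}) (i : {linear M -> B}),
  [/\ onto p, injective i & forall x, i (p x) = f x].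
Proof.
have [M [i [ii iE]]] := submodule_exists (submodule_range f).
have [|p pE] := @lift_through_inj _ _ _ i f ii; first by move=> x; apply/iE; exists x.
exists M, p, i; split=> // y; have /iE[x e] : exists z, i z = i y by exists y.
by exists x; apply: ii; rewrite pE.
Qed.

Definition short_exact A B C (a : {linear A -> B}) (b : {linear B -> C}) :=
  [/\ injective a, exact a b & onto b].

Lemma exact_comp0 A B C (a : {linear A -> B}) (b : {linear B -> C}) x :
  exact a b -> b (a x) = 0.
Proof. by move=> e; apply/e; exists x. Qed.

Definition lcombf M k (x : 'I_k -> M) (r : 'rV[R]_k) := \sum_i r 0 i *: x i.
Lemma lcomb_linear M k (x : 'I_k -> M) : linear (lcombf x).
Proof.
move=> a u v; rewrite /lcombf scaler_sumr -big_split; apply: eq_bigr => i _ /=.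
by rewrite !mxE scalerDl scalerA.
Qed.
HB.instance Definition _ M k (x : 'I_k -> M) :=
  GRing.isLinear.Build R 'rV[R]_k M _ (lcombf x) (lcomb_linear x).
Definition lcomb M k (x : 'I_k -> M) : {linear 'rV[R]_k -> M} := lcombf x.

Definition unit_row k (i : 'I_k) : 'rV[R]_k := \row_j (if i == j then 1 else 0).
Lemma row_sum_unit k (r : 'rV[R]_k) : r = \sum_i r 0 i *: unit_row i.
Proof.
apply/rowP=> j; rewrite summxE (bigD1 j) //= big1 => [|i ne]; rewrite !mxE.
  by rewrite eqxx mulr1 addr0.
by rewrite (negbTE ne) mulr0.
Qed.
Lemma lcomb_unit M k (x : 'I_k -> M) i : lcomb x (unit_row i) = x i.
Proof.
rewrite /lcomb /= /lcombf (bigD1 i) //= big1 => [|j ne]; rewrite !mxE.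
  by rewrite eqxx scale1r addr0.
by rewrite eq_sym (negbTE ne) scale0r.
Qed.

Lemma fin_genP M : fin_gen M <-> exists k (x : 'I_k -> M), onto (lcomb x).
Proof.
split=> [[s sE]|[k [x xo]]].
  exists (size s), (fun i => s`_i) => y; have [c ->] := sE y.
  by exists (\row_i c i); apply: eq_bigr => i _; rewrite mxE.
exists (codom x) => y; have [r <-] := xo y.
have e : k = size (codom x) by rewrite size_codom card_ord.
exists (fun i => r 0 (cast_ord (esym e) i)).
rewrite (reindex (cast_ord e)) /=; last first.
  by exists (cast_ord (esym e)) => i _; rewrite ?cast_ordK ?cast_ordKV.
rewrite /lcomb /= /lcombf; apply: eq_bigr => i _; rewrite cast_ordK.
by rewrite codomE (nth_map i) ?size_enum_ord //= nth_ord_enum.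
Qed.

Lemma fin_gen_onto M N (f : {linear M -> N}) : onto f -> fin_gen M -> fin_gen N.
Proof.
move=> fo /fin_genP[k [x xo]]; apply/fin_genP; exists k, (fun i => f (x i)) => y.
have [z <-] := fo y; have [r <-] := xo z; exists r.
by rewrite /lcomb /= /lcombf linear_sum; apply: eq_bigr => i _; rewrite linearZ.
Qed.

Lemma fin_gen_row k : fin_gen 'rV[R]_k.
Proof.
by apply/fin_genP; exists k, (@unit_row k) => r; exists r; rewrite [RHS]row_sum_unit.
Qed.

(** Induction on the number of generators: the coefficients of the first
    generator in the elements of S form a left ideal, finitely generated by
    hypothesis; after subtracting lifts of its generators, an element of S falls
    in the span of the other generators. *)
Lemma noetherian_submodule M k (x : 'I_k -> M) (S : M -> Prop) : left_noetherian R ->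
  submodule S -> (forall y, S y -> exists r, lcomb x r = y) ->
  exists l (z : 'I_l -> M), (forall i, S (z i)) /\ forall y, S y -> exists r, lcomb z r = y.
Proof.
move=> noeth; elim: k x S => [|k IH] x S sS Sx.
  exists 0%N, x; split=> //; first by case.
pose x' i := x (lift ord0 i).
have xE r : lcomb x r = r 0 ord0 *: x ord0 + lcomb x' (\row_i r 0 (lift ord0 i)).
  rewrite /lcomb /= /lcombf big_ord_recl; congr (_ + _).
  by apply: eq_bigr => i _; rewrite mxE.
pose I (a : R^o) := exists r, S ((a : R) *: x ord0 + lcomb x' r).
have [U UI] : exists U : submodClosed R^o, forall a, a \in U <-> I a.
  apply: submodule_closed; split=> [|a b c [r Sr] [t St]].
    by exists 0; rewrite scale0r add0r linear0; exact: sS.1.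
  exists (a *: r + t).
  suff -> : ((a *: b + c : R^o) : R) *: x ord0 + lcomb x' (a *: r + t) =
    a *: ((b : R) *: x ord0 + lcomb x' r) + ((c : R) *: x ord0 + lcomb x' t).
    exact: sS.2.
  by rewrite linearP scalerDr scalerA addrACA -scalerDl.
have [s sU] := noeth U.
have sI (i : 'I_(size s)) : I s`_i.
  apply/UI/sU; exists (unit_row i 0); rewrite (bigD1 i) //= big1 => [|j ne].
    by rewrite !mxE eqxx scale1r addr0.
  by rewrite !mxE eq_sym (negbTE ne) scale0r.
have [t tS] := choice sI.
pose y (i : 'I_(size s)) := ((s`_i : R^o) : R) *: x ord0 + lcomb x' (t i).
have [||l [z [zS zgen]]] := IH x' (fun v => S v /\ exists r, lcomb x' r = v).
- split=> [|a u v [Su [r rE]] [Sv [q qE]]].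
    by split; [exact: sS.1 | exists 0; rewrite linear0].
  by split; [exact: sS.2 | exists (a *: r + q); rewrite linearP rE qE].
- by move=> v [].
exists (size s + l)%N,
  (fun i => match fintype.split i with inl j => y j | inr j => z j end).
split=> [i|v Sv]; first by case: fintype.split => j; [exact: tS | case: (zS j)].
have [r rE] := Sx v Sv; rewrite xE in rE.
have /sU[c cE] : r 0 ord0 \in U by apply/UI; exists (\row_i r 0 (lift ord0 i)); rewrite rE.
have [|q qE] := zgen (v - \sum_i c i *: y i).
  split.
    rewrite addrC -scaleN1r; apply: sS.2 => //.
    elim/big_ind : _ => [|u w Su Sw|i _]; first exact: sS.1.
      by rewrite -[u]scale1r; apply: sS.2.
    by rewrite -[_ *: _]addr0; apply: sS.2 sS.1; exact: tS.
  exists (\row_i r 0 (lift ord0 i) - \sum_i c i *: t i).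
  rewrite -rE /y.
  under [in RHS]eq_bigr do rewrite scalerDr scalerA.
  rewrite big_split /= -scaler_suml opprD addrACA.
  have -> : r 0 ord0 *: x ord0 - (\sum_i c i * s`_i) *: x ord0 = 0.
    by rewrite cE subrr.
  rewrite add0r linearB; congr (_ - _); rewrite (linear_sum (lcomb x')).
  by apply: eq_bigr => i _; rewrite linearZ.
exists (row_mx (\row_i c i) q); rewrite /lcomb /= /lcombf big_split_ord /=.
under eq_bigr => i _ do rewrite row_mxEl mxE (unsplitK (inl i)).
under [X in _ + X]eq_bigr => i _ do rewrite row_mxEr (unsplitK (inr i)).
by move: qE; rewrite /lcomb /= /lcombf => ->; rewrite addrC subrK.
Qed.

Lemma fin_gen_sub A B (i : {linear A -> B}) : left_noetherian R ->
  injective i -> fin_gen B -> fin_gen A.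
Proof.
move=> noeth ii /fin_genP[k [x xo]].
have [y _|l [z [/choice[w wE] zgen]]] := noetherian_submodule noeth (submodule_range i) (x := x).
  exact: xo.
apply/fin_genP; exists l, w => y; have [|r rE] := zgen (i y); first by exists y.
exists r; apply: ii; rewrite -rE /lcomb /= /lcombf linear_sum.
by apply: eq_bigr => j _; rewrite linearZ wE.
Qed.
End Maps.

(** * Free and projective modules *)

Section Free.
Variable R : pzRingType.
Implicit Types A B C D M N P : lmodType R.

Definition copies_coordf (X : Type) M (x : X) (f : copies X M) : M := f x.
Lemma copies_coord_linear X M x : linear (@copies_coordf X M x).
Proof. by []. Qed.
HB.instance Definition _ X M x :=
  GRing.isLinear.Build R (copies X M) M _ (@copies_coordf X M x) (@copies_coord_linear X M x).
Definition copies_coord X M x : {linear copies X M -> M} := @copies_coordf X M x.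

Lemma copies_ext X M (f g : copies X M) : f =1 g -> f = g.
Proof. by move=> /funext e; apply: val_inj. Qed.

Lemma copies_support (X : choiceType) M (f : copies X M) :
  exists s : seq X, uniq s /\ forall x, x \notin s -> f x = 0.
Proof.
case: f => f /= /asboolP/finite_seqP[s sE]; exists (undup s); split.
  exact: undup_uniq.
move=> x; rewrite mem_undup => xs; apply/eqP; apply: contraNT xs => fx.
by have : ([set` s])%classic x by rewrite -sE.
Qed.

Lemma copies_finite (X : choiceType) M (s : seq X) (c : X -> M) :
  exists f : copies X M, forall x, f x = if x \in s then c x else 0.
Proof.
have F : (fun x => if x \in s then c x else 0) \in @finsupp R X M.
  apply/asboolP; apply: (sub_finite_set (B := [set` s]%classic)); last exact: finite_seq.
  by move=> x /=; case: ifP => //; rewrite eqxx.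
by exists (Copies F).
Qed.

Lemma big_support (X : choiceType) M (f : X -> M) (s t : seq X) : uniq s -> uniq t ->
  (forall x, x \notin s -> f x = 0) -> (forall x, x \notin t -> f x = 0) ->
  \sum_(x <- s) f x = \sum_(x <- t) f x.
Proof.
move=> us ut s0 t0.
rewrite (bigID (mem t)) /= [X in _ + X]big1 ?addr0; last by move=> x /t0.
rewrite [RHS](bigID (mem s)) /= [X in _ = _ + X]big1 ?addr0; last by move=> x /s0.
rewrite -big_filter -[RHS]big_filter; apply/perm_big/uniq_perm; rewrite ?filter_uniq //.
by move=> x; rewrite !mem_filter andbC.
Qed.

(** A finitely supported family acts as a formal linear combination; [s] is any
    finite set containing its support. *)
Lemma free_extend (X : choiceType) M (h : X -> M) :
  exists g : {linear copies X R^o -> M}, forall (f : copies X R^o) (s : seq X), uniq s ->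
    (forall x, x \notin s -> f x = 0) -> g f = \sum_(x <- s) (f x : R) *: h x.
Proof.
have ex (f : copies X R^o) : exists y, forall s, uniq s ->
    (forall x, x \notin s -> f x = 0) -> y = \sum_(x <- s) (f x : R) *: h x.
  have [s [us s0]] := copies_support f; exists (\sum_(x <- s) (f x : R) *: h x) => t ut t0.
  by apply: big_support => // x xs; [rewrite s0 | rewrite t0]; rewrite ?scale0r.
have [g gE] := choice ex; have [|k kE] := @linear_exists _ _ _ g; last first.
  by exists k => f s us s0; rewrite kE; apply: gE.
move=> a f f'; have [s [us s0]] := copies_support f; have [t [ut t0]] := copies_support f'.
have u := undup_uniq (s ++ t).
have v0 x : x \notin undup (s ++ t) -> f x = 0 /\ f' x = 0.
  by rewrite mem_undup mem_cat negb_or => /andP[/s0 ? /t0 ?].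
rewrite (gE f _ u) => [|x /v0[] //]; rewrite (gE f' _ u) => [|x /v0[] //].
rewrite (gE _ _ u) => [|x /v0[fx f'x]].
  rewrite scaler_sumr -big_split; apply: eq_bigr => x _ /=.
  by rewrite scalerA -scalerDl.
by change (a *: f x + f' x = 0); rewrite fx f'x scaler0 addr0.
Qed.

(** The basis vector of the free module at [x]. *)
Definition delta_spec (X : choiceType) (x : X) (f : copies X R^o) :=
  forall y, f y = if y == x then 1 else 0 : R.
Lemma delta_exists (X : choiceType) : exists d : X -> copies X R^o, forall x, delta_spec x (d x).
Proof.
suff /choice[d dE] : forall x : X, exists f, delta_spec x f by exists d.
move=> x; have [f fE] := @copies_finite X R^o [:: x] (fun=> 1 : R).
by exists f => y; rewrite fE inE.
Qed.

Lemma delta_sum (X : choiceType) (d : X -> copies X R^o) : (forall x, delta_spec x (d x)) ->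
  forall (f : copies X R^o) (s : seq X), uniq s ->
    (forall x, x \notin s -> f x = 0) -> f = \sum_(x <- s) (f x : R) *: d x.
Proof.
move=> dE f s us s0; apply: copies_ext => y.
rewrite -[RHS]/(copies_coord R^o y _) linear_sum /=.
have e x : copies_coordf y ((f x : R) *: d x) = if y == x then f x else 0.
  change ((f x : R) * d x y = if y == x then f x else 0); rewrite dE.
  by case: eqP => _; rewrite ?mulr1 ?mulr0.
rewrite (eq_bigr _ (fun x _ => e x)).
have [ys|ys] := boolP (y \in s); last first.
  rewrite s0 // big1_seq // => x /andP[_ xs]; case: eqP => // yx.
  by rewrite yx xs in ys.
rewrite (bigD1_seq y) //= eqxx big1 ?addr0 // => x xy.
by rewrite eq_sym (negbTE xy).
Qed.

Lemma free_projective (X : choiceType) : projective (copies X R^o : lmodType R).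
Proof.
move=> A B g f go; have [d dE] := delta_exists X.
have [h hE] := choice (fun x => go (f (d x))).
have [k kE] := free_extend h; exists k => y.
have [s [us s0]] := copies_support y.
rewrite (kE _ _ us s0) [in RHS](delta_sum dE us s0) !linear_sum.
by apply: eq_bigr => x _; rewrite !linearZ /= hE.
Qed.

Lemma row_projective k : projective ('rV[R]_k : lmodType R).
Proof.
move=> A B g f go; have [h hE] := choice (fun i => go (f (unit_row R i))).
exists (lcomb h) => r; rewrite [in RHS](row_sum_unit r) /lcomb /= /lcombf !linear_sum.
by apply: eq_bigr => i _; rewrite !linearZ /= hE.
Qed.

Lemma proj_cover M : exists (P : lmodType R) (p : {linear P -> M}), projective P /\ onto p.
Proof.
have [p pE] := free_extend (@id M); exists (copies M R^o), p; split.
  exact: free_projective.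
move=> x; have [d dE] := delta_exists M; exists (d x).
rewrite (pE _ [:: x]) //; first by rewrite big_seq1 dE eqxx scale1r.
by move=> y; rewrite inE dE => /negbTE ->.
Qed.

Lemma fin_gen_cover M : fin_gen M -> exists (P : lmodType R) (p : {linear P -> M}),
  [/\ projective P, fin_gen P & onto p].
Proof.
move=> /fin_genP[k [x xo]]; exists 'rV[R]_k, (lcomb x).
by split=> //; [exact: row_projective | exact: fin_gen_row].
Qed.

Lemma projective_retract P M (s : {linear M -> P}) (r : {linear P -> M}) :
  projective P -> (forall x, r (s x) = x) -> projective M.
Proof.
move=> pP rs A B g f go; have [h hE] := pP _ _ g (lcomp f r) go.
by exists (lcomp h s) => x /=; rewrite hE /= rs.
Qed.

(** A dual basis, relative to a map from a finitely generated module: the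
    coordinates of a section of a free cover, of which only finitely many are
    nonzero on the image of D. *)
Lemma proj_basis P D (b : {linear D -> P}) : projective P -> fin_gen D ->
  exists k (x : 'I_k -> P) (u : 'I_k -> {linear D -> R^o}),
    forall y, b y = \sum_i (u i y : R) *: x i.
Proof.
move=> pP /fin_genP[m [z zo]]; have [p pE] := free_extend (@id P).
have po : onto p.
  move=> x; have [d dE] := delta_exists P; exists (d x).
  rewrite (pE _ [:: x]) //; first by rewrite big_seq1 dE eqxx scale1r.
  by move=> y; rewrite inE dE => /negbTE ->.
have [sg sgE] := pP _ _ p (lid P) po.
have [S SE] := choice (fun i => copies_support (sg (b (z i)))).
pose s := undup (flatten (codom S)).
have sb y x : x \notin s -> sg (b y) x = 0.
  have [r <-] := zo y => xs; rewrite -[LHS]/(copies_coord R^o x _).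
  rewrite /lcomb /= /lcombf !linear_sum big1 // => i _; rewrite !linearZ /=.
  suff -> : copies_coordf x (sg (b (z i))) = 0 by rewrite scaler0.
  apply: (SE i).2; apply: contra xs; rewrite mem_undup => xi.
  by apply/flattenP; exists (S i) => //; apply: codom_f.
exists (size s), (tnth (in_tuple s)).
exists (fun i => lcomp (lcomp (copies_coord R^o (tnth (in_tuple s) i)) sg) b) => y.
rewrite -[LHS](sgE (b y)) (pE _ s) ?undup_uniq //; last exact: sb.
by rewrite big_tnth.
Qed.

(** For M -> P this is surjectivity of the dual map P* -> M*: the map is a left
    approximation by projectives. *)
Definition forms_extend A B (a : {linear A -> B}) :=
  forall u : {linear A -> R^o}, exists v : {linear B -> R^o}, forall x, v (a x) = u x.

(** By [proj_basis] a map to a projective is a finite combination of forms. *)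
Lemma forms_extend_proj A B (a : {linear A -> B}) P (g : {linear A -> P}) :
  fin_gen A -> forms_extend a -> projective P ->
  exists h : {linear B -> P}, forall x, h (a x) = g x.
Proof.
move=> fA ea pP; have [k [x [u uE]]] := proj_basis g pP fA.
have [v vE] := choice (fun i => ea (u i)).
have [|h hE] := @linear_exists _ B P (fun y => \sum_i (v i y : R) *: x i).
  move=> c y y'; rewrite scaler_sumr -big_split; apply: eq_bigr => i _ /=.
  by rewrite linearP scalerDl scalerA.
by exists h => y; rewrite hE uE; apply: eq_bigr => i _; rewrite vE.
Qed.
End Free.

(** * Syzygies and torsionfree modules, one step at a time *)

Section Syzygy.
Variable R : pzRingType.
Implicit Types A B C D M N P : lmodType R.

(** [class_Omega] unfolded along the cokernel of its first map, which makes
    induction on [i] possible. *)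
Fixpoint syz (i : nat) M : Prop :=
  if i is i'.+1 then
    fin_gen M /\ exists P N (a : {linear M -> P}) (b : {linear P -> N}),
      [/\ fin_gen P, projective P, short_exact a b & syz i' N]
  else fin_gen M.

Lemma iso_refl M : iso M M.
Proof. by exists (lid M); exists id. Qed.

(** The cokernel N of X 0 -> X 1 embeds in X 2, so that the rest of the sequence
    exhibits N as an (i-1)-st syzygy. *)
Lemma class_Omega_syz i M : class_Omega i M -> syz i M.
Proof.
elim: i M => [|i IH] M [fM [X [d [[f fb] d0 ex dn [XP fX]]]]] //=.
split=> //; pose a := lcomp (d 0%N) f; have [N [p [po pa]]] := cokernel_exists a.
have fi : injective f by case: fb => g fK _; exact: can_inj fK.
have [g fK gK] := fb.
have aE x y : a x = y <-> d 0%N (f x) = y by [].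
have [|e eE] := @factor_through_onto _ _ _ _ p (d 1%N) po.
  by move=> x /pa[y <-]; apply/(ex 0%N) => //; exists (f y).
have [fX1 pX1] := XP 1%N erefl.
exists (X 1%N), N, a, p; split=> //.
  by split=> // x y; rewrite /a /= => /d0/fi.
apply: IH; split; first exact: fin_gen_onto po fX1.
pose X' k := match k with 0 => N | k'.+1 => X k'.+2 end.
pose d' k : {linear X' k -> X' k.+1} :=
  match k return {linear X' k -> X' k.+1} with 0 => e | k'.+1 => d k'.+2 end.
have re y : (exists x, d 1%N x = y) <-> exists x, e x = y.
  split=> [[x <-]|[x <-]]; first by exists (p x).
  by have [z <-] := po x; exists z.
exists X', d'; split.
- exact: iso_refl.
- apply: linear_injective => x; have [z <-] := po x; rewrite /= eE => /(ex 0%N)-/(_ erefl)[y yz].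
  by apply/pa; exists (g y); rewrite /a /= gK.
- case=> [|k] ki /=; last exact: (ex k.+2).
  by move=> y; rewrite (ex 1%N) // re.
- case: i {ex XP fX} dn @d' => [|i] dn /=; last exact: dn.
  by move=> y; have [x <-] := dn y; exists (p x).
- split=> //; case=> // k /= ki; exact: (XP k.+2).
Qed.

Lemma syz_class_Omega i M : syz i M -> class_Omega i M.
Proof.
elim: i M => [|i IH] M.
  move=> fM; split=> //; exists (fun=> M), (fun=> lid M); split=> //.
  - exact: iso_refl.
  - by move=> x; exists x.
  - by split=> //; case.
case=> fM [P [N [a [b [fP pP [ai ab bo] /IH]]]]].
case=> fN [X [d [[f [g fK gK]] d0 ex dn [XP fX]]]]; split=> //.
pose Y k := match k with 0 => M | 1 => P | k'.+2 => X k'.+1 end.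
pose d1 := lcomp (d 0%N) (lcomp f b).
pose e k : {linear Y k -> Y k.+1} := match k return {linear Y k -> Y k.+1} with
  0 => a | 1 => d1 | k'.+2 => d k'.+1 end.
exists Y, e; split=> //.
- exact: iso_refl.
- case=> [|[|k]] ki /=.
  + move=> y; rewrite -(ab y) /d1 /=; split=> [e0|-> //]; last by rewrite !linear0.
    by apply: (can_inj fK); rewrite linear0; apply: d0; rewrite linear0.
  + move=> y; rewrite (ex 0%N) //; split=> [[x <-]|[x <-]]; last by exists (f (b x)).
    by have [z zE] := bo (g x); exists z; rewrite /d1 /= zE gK.
  + exact: (ex k.+1).
- case: i {IH ex XP fX} dn @e => [|i] dn /= y; last exact: dn.
  have [x <-] := dn y; have [z zE] := bo (g x).
  by exists z; rewrite /d1 /= zE gK.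
- split=> //; case=> [|[|k]] //= ki; exact: (XP k.+1).
Qed.

Lemma class_OmegaP i M : class_Omega i M <-> syz i M.
Proof. by split; [exact: class_Omega_syz | exact: syz_class_Omega]. Qed.

(** The syzygies whose successive embeddings are left approximations. *)
Fixpoint torsionfree (i : nat) M : Prop :=
  if i is i'.+1 then
    fin_gen M /\ exists P N (a : {linear M -> P}) (b : {linear P -> N}),
      [/\ fin_gen P, projective P, short_exact a b, forms_extend a & torsionfree i' N]
  else fin_gen M.

Lemma torsionfree_fg i M : torsionfree i M -> fin_gen M.
Proof. by case: i => // i []. Qed.

Lemma torsionfree_syz i M : torsionfree i M -> syz i M.
Proof.
elim: i M => //= i IH M [fM [P [N [a [b [fP pP ab _ /IH sN]]]]]].
by split=> //; exists P, N, a, b.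
Qed.

End Syzygy.

(** * Vanishing of Ext does not depend on the resolution *)

Section Resolutions.
Variable R : pzRingType.
Implicit Types A B C D K M N P T U W Z : lmodType R.

Definition resolution_prepend (Q : lmodType R -> Prop) K P M (a : {linear K -> P})
  (b : {linear P -> M}) (ab : short_exact a b) (QP : Q P) (r : resolution Q K) :
  resolution Q M.
Proof.
pose X k : lmodType R := match k with 0 => P | k'.+1 => r k' end.
pose d k : {linear X k.+1 -> X k} := match k return {linear X k.+1 -> X k} with
  0 => lcomp a (res_aug r) | k'.+1 => res_d r k' end.
refine (@Resolution R Q M X d b _ _ _ _).
- by case: ab.
- case: ab => ai abE bo y; rewrite abE; split=> [[x <-]|[x <-]].
    by have [z <-] := res_aug_onto r x; exists z.
  by exists (res_aug r x).
- case=> [|k] y; last exact (res_exact r k y).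
  rewrite -(res_exact0 r y) /=; split=> [|->]; last by rewrite linear0.
  by case: ab => ai _ _; apply: injective_eq0.
- by case=> [|k] //; exact: res_class.
Defined.

(** The third clause transfers exactness of Hom(-, N) in degree j + 2 to degree
    j + 1 of the shifted resolution. *)
Lemma resolution_tail (Q : lmodType R -> Prop) M (r : resolution Q M) :
  exists K (k : {linear K -> r 0%N}) (r' : resolution Q K),
    [/\ short_exact k (res_aug r), forall j, Q (r j),
        forall N j, (forall phi : {linear r j.+2 -> N}, (forall x, phi (res_d r j.+2 x) = 0) ->
          exists psi : {linear r j.+1 -> N}, forall x, phi x = psi (res_d r j.+1 x)) ->
          forall phi : {linear r' j.+1 -> N}, (forall x, phi (res_d r' j.+1 x) = 0) ->
          exists psi : {linear r' j -> N}, forall x, phi x = psi (res_d r' j x) &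
        exists2 p : {linear r 1%N -> K}, onto p &
          (forall x, p (res_d r 1%N x) = 0) /\ forall x, res_d r 0%N x = k (p x)].
Proof.
have [K [k [ki kE]]] := kernel_exists (res_aug r).
have [|p pE] := @lift_through_inj _ _ _ _ k (res_d r 0%N) ki.
  by move=> x; apply/kE/(res_exact0 r); exists x.
have po : onto p.
  move=> y; have /(res_exact0 r)[x xE] : res_aug r (k y) = 0 by apply: exact_comp0 kE.
  by exists x; apply: ki; rewrite pE.
have pE0 x : p x = 0 <-> res_d r 0%N x = 0.
  by rewrite -pE; split=> [->|]; [rewrite linear0 | apply: injective_eq0].
pose r' : resolution Q K := @Resolution R Q K (fun j => r j.+1) (fun j => res_d r j.+1) p
  po (fun y => iff_trans (pE0 y) (res_exact r 0%N y)) (fun j => res_exact r j.+1)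
  (fun j => res_class r j.+1).
exists K, k, r'; split=> //.
- by split=> //; exact: res_aug_onto.
- by move=> j; exact: res_class.
- by exists p => //; split=> // x; apply/pE0/(res_exact r 0%N); exists x.
Qed.

(** Ext^(j+1)(T, N) = 0 by dimension shifting, the syzygies being kernels of
    some surjections from projectives here, and of arbitrary ones in
    [ext_zero_all]. *)
Fixpoint ext_zero_some (j : nat) T N : Prop :=
  exists K P (a : {linear K -> P}) (b : {linear P -> T}),
  [/\ projective P, short_exact a b &
    if j is j'.+1 then ext_zero_some j' K N else
      forall u : {linear K -> N}, exists v : {linear P -> N}, forall x, v (a x) = u x].

Fixpoint ext_zero_all (j : nat) T N : Prop :=
  forall K P (a : {linear K -> P}) (b : {linear P -> T}), projective P -> short_exact a b ->
    if j is j'.+1 then ext_zero_all j' K N else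
      forall u : {linear K -> N}, exists v : {linear P -> N}, forall x, v (a x) = u x.

Lemma short_exact_cover M : exists K P (a : {linear K -> P}) (b : {linear P -> M}),
  projective P /\ short_exact a b.
Proof.
have [P [b [pP bo]]] := proj_cover M; have [K [a [ai aE]]] := kernel_exists b.
by exists K, P, a, b.
Qed.

Lemma ext_zero_all_some j T N : ext_zero_all j T N -> ext_zero_some j T N.
Proof.
elim: j T => [|j IH] T Z; have [K [P [a [b [pP ab]]]]] := short_exact_cover T;
  exists K, P, a, b; split=> //.
  exact: (Z _ _ a b pP ab).
by apply: IH; exact: (Z _ _ a b pP ab).
Qed.

(** W is a retract of U up to maps that factor through a projective module.
    This relation, unlike isomorphism, is inherited by all choices of syzygies:
    it is the form of Schanuel's lemma that [stable_retract_ext_zero] needs. *)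
Definition stable_retract U W :=
  exists (f : {linear U -> W}) (g : {linear W -> U})
    Z (a : {linear Z -> W}) (b : {linear W -> Z}),
    projective Z /\ forall w, w = f (g w) + a (b w).

(** Lift f and g to the covers as F and H, and lift the factor a of 1 - f g; then
    1 - F H, corrected by that lift, maps Q to the kernel W' and is the map s. *)
Lemma stable_retract_syz U W U' W' P (Q : lmodType R)
   (k : {linear U' -> P}) (p : {linear P -> U})
   (l : {linear W' -> Q}) (q : {linear Q -> W}) :
  stable_retract U W -> projective P -> projective Q -> short_exact k p -> short_exact l q ->
  exists (H : {linear Q -> P}) (s : {linear Q -> W'})
    (f : {linear U' -> W'}) (g : {linear W' -> U'}),
    (forall x, k (g x) = H (l x)) /\ forall x, x = f (g x) + s (l x).
Proof.
move=> [f [g [Z [a [b [pZ E]]]]]] pP pQ [ki kE po] [li lE qo].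
have [F FE] := pP _ _ q (lcomp f p) qo; have [H HE] := pQ _ _ p (lcomp g q) po.
have [a' a'E] := pZ _ _ q a qo; rewrite /= in FE HE.
pose e := lsub (lsub (lid Q) (lcomp F H)) (lcomp (lcomp a' b) q).
have [|s sE] := @lift_through_inj _ _ _ _ l e li.
  move=> x; apply/lE; rewrite /= !linearB /= FE HE a'E.
  by apply/eqP; rewrite -addrA -opprD subr_eq0; apply/eqP/E.
have [|f' f'E] := @lift_through_inj _ _ _ _ l (lcomp F k) li.
  by move=> x; apply/lE; rewrite /= FE (exact_comp0 x kE) linear0.
have [|g' g'E] := @lift_through_inj _ _ _ _ k (lcomp H l) ki.
  by move=> x; apply/kE; rewrite /= HE (exact_comp0 x lE) linear0.
exists H, s, f', g'; split=> // x; apply: li.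
by rewrite linearD f'E sE /= g'E /= (exact_comp0 x lE) !linear0 addr0 addrC subrK.
Qed.

(** In degree one, a map u on W' is extended by v H + u s, where v extends u f. *)
Lemma stable_retract_ext_zero j U W N :
  stable_retract U W -> ext_zero_some j U N -> ext_zero_all j W N.
Proof.
elim: j U W => [|j IH] U W UW [U' [P [k [p [pP kp]]]]] E W' Q l q pQ lq;
  have [H [s [f [g [gE xE]]]]] := stable_retract_syz UW pP pQ kp lq.
  move=> u; have [v vE] := E (lcomp u f); exists (ladd (lcomp v H) (lcomp u s)) => x.
  by rewrite /= -gE vE /= -linearD -xE.
by apply: IH E; exists f, g, Q, s, l.
Qed.

Lemma ext_zero_some_all j T N : ext_zero_some j T N -> ext_zero_all j T N.
Proof.
apply: stable_retract_ext_zero; exists (lid T), (lid T), 'rV[R]_0, (lzero _ _), (lzero _ _).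
by split=> [|w]; [exact: row_projective | rewrite /= addr0].
Qed.

Lemma Ext_eq0_ext_zero j T N : Ext_eq0 j.+1 T N -> ext_zero_some j T N.
Proof.
elim: j T => [|j IH] T [r rE];
  have [K [k [r' [kp pr shift [p po [pd dE]]]]]] := resolution_tail r;
  exists K, (r 0%N), k, (res_aug r); split=> //.
  move=> u; have [|v vE] := rE (lcomp u p); first by move=> x; rewrite /= pd linear0.
  by exists v => x; have [z <-] := po x; rewrite -dE -vE.
by apply: IH; exists r' => phi; apply: shift.
Qed.

(** A single record, so that one choice gives a surjection from a projective,
    together with its kernel, for all modules at once. *)
Record cover M := Cover { cov_K : lmodType R; cov_P : lmodType R;
  cov_a : {linear cov_K -> cov_P}; cov_b : {linear cov_P -> M};
  cov_proj : projective cov_P; cov_ses : short_exact cov_a cov_b }.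

Lemma cover_inhabited M : exists c : cover M, True.
Proof.
by have [K [P [a [b [pP ab]]]]] := short_exact_cover M; exists (Cover pP ab).
Qed.
Definition some_cover M : cover M := projT1 (cid (cover_inhabited M)).

Fixpoint cover_syz M k : lmodType R :=
  if k is k'.+1 then cov_K (some_cover (cover_syz M k')) else M.

Definition proj_resolution M : resolution (@projective R) M.
Proof.
pose c k := some_cover (cover_syz M k).
pose d k : {linear cov_P (c k.+1) -> cov_P (c k)} := lcomp (cov_a (c k)) (cov_b (c k.+1)).
have cE k y : cov_b (c k) y = 0 <-> exists x, d k x = y.
  have [_ abE _] := cov_ses (c k); have [_ _ bo] := cov_ses (c k.+1).
  rewrite abE; split=> [[x <-]|[x <-]]; last by exists (cov_b (c k.+1) x).
  by have [z <-] := bo x; exists z.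
refine (@Resolution R _ M (fun k => cov_P (c k)) d (cov_b (c 0%N)) _ _ _ _).
- by case: (cov_ses (c 0%N)).
- exact: cE.
- move=> k y; rewrite -cE /d /=; split=> [|->]; last by rewrite linear0.
  by case: (cov_ses (c k)) => ai _ _; apply: injective_eq0.
- by move=> k; exact: cov_proj.
Defined.

Lemma ext_zero_Ext_eq0 j T N : ext_zero_some j T N -> Ext_eq0 j.+1 T N.
Proof.
elim: j T => [|j IH] T [K [P [a [b [pP ab E]]]]].
  exists (resolution_prepend ab pP (proj_resolution K)) => phi phi0.
  have [|u uE] := @factor_through_onto _ _ _ _ _ phi (res_aug_onto (proj_resolution K)).
    by move=> x /(res_exact0 (proj_resolution K))[y <-]; exact: phi0.
  have [v vE] := E u; exists v => x.
  exact (esym (etrans (vE (res_aug (proj_resolution K) x)) (uE x))).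
have [r rE] := IH _ E; exists (resolution_prepend ab pP r) => phi; exact: rE.
Qed.

(** The existential choice of a resolution in [Ext_eq0] is thus immaterial. *)
Lemma Ext_eq0P j T N : Ext_eq0 j.+1 T N <-> ext_zero_some j T N.
Proof. by split; [exact: Ext_eq0_ext_zero | exact: ext_zero_Ext_eq0]. Qed.
End Resolutions.

(** * Duality and the transpose *)

Section Duality.
Variable R : pzRingType.
Implicit Types A B C D L M N P : lmodType R.
Implicit Types S T K : lmodType R^c.

Lemma dualE M (w : dual M) a x y : w (a *: x + y) = a * (w x : R) + (w y : R) :> R.
Proof. by case: w => w /= /asboolP; exact. Qed.

Lemma dual_ext M (v w : dual M) : v =1 w -> v = w.
Proof. by move=> /funext e; apply: val_inj. Qed.

Lemma dual_lin M (w : dual M) : exists u : {linear M -> R^o}, forall x, u x = w x.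
Proof. by apply: linear_exists => a x y; exact: dualE. Qed.

Lemma lin_dual M (u : {linear M -> R^o}) : exists w : dual M, forall x, w x = u x.
Proof.
have F : (u : M -> R^c^o) \in @is_form R M by apply/asboolP=> a x y; exact: linearP.
by exists (Dual F).
Qed.

Definition evalf M (x : M) (w : dual M) : R^c^o := w x.
Lemma evalf_linear M (x : M) : linear (evalf x).
Proof. by []. Qed.
HB.instance Definition _ M (x : M) :=
  GRing.isLinear.Build R^c (dual M) R^c^o _ (evalf x) (evalf_linear x).
Definition eval M (x : M) : {linear dual M -> R^c^o} := evalf x.

Lemma dual_sum M k (w : 'I_k -> dual M) (c : 'I_k -> R^c) x :
  (\sum_i c i *: w i) x = \sum_i (w i x : R) * (c i : R) :> R.
Proof. by rewrite -[LHS]/(eval x _) linear_sum. Qed.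

(** The identity of a finitely generated projective module is a combination of
    forms; the same data is a dual basis of the dual module. *)
Lemma dual_basis P : fin_gen P -> projective P ->
  exists k (x : 'I_k -> P) (w : 'I_k -> dual P),
    (forall y, y = \sum_i (w i y : R) *: x i) /\
    forall u : dual P, u = \sum_i (u (x i) : R^c) *: w i.
Proof.
move=> fP pP; have [k [x [u uE]]] := proj_basis (lid P) pP fP.
have [w wE] := choice (fun i => lin_dual (u i)).
have xE y : y = \sum_i (w i y : R) *: x i.
  by rewrite -[LHS]/(lid P y) uE; apply: eq_bigr => i _; rewrite wE.
exists k, x, w; split=> // v; apply: dual_ext => y; rewrite dual_sum.
have [v' v'E] := dual_lin v.
rewrite [in LHS](xE y) -v'E linear_sum; apply: eq_bigr => i _.
by rewrite linearZ v'E.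
Qed.

Lemma dual_projective P : fin_gen P -> projective P -> projective (dual P).
Proof.
move=> fP pP A B g f go; have [k [x [w [_ wE]]]] := dual_basis fP pP.
have [h hE] := choice (fun i => go (f (w i))).
have [|H HE] := @linear_exists _ (dual P) A (fun u => \sum_i (u (x i) : R^c) *: h i).
  move=> a u v; rewrite scaler_sumr -big_split; apply: eq_bigr => i _ /=.
  by rewrite scalerA -scalerDl.
exists H => u; rewrite HE [in RHS](wE u) !linear_sum.
by apply: eq_bigr => i _; rewrite !linearZ hE.
Qed.

(** Expanding an element of P* in the dual basis shows that phi is evaluation at the
    sum of the elements phi (w i) x i. *)
Lemma bidual P (phi : {linear dual P -> R^c^o}) : fin_gen P -> projective P ->
  exists z : P, forall u, phi u = u z.
Proof.
move=> fP pP; have [k [x [w [_ wE]]]] := dual_basis fP pP.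
exists (\sum_i (phi (w i) : R) *: x i) => u.
have [u' u'E] := dual_lin u; rewrite -u'E linear_sum [in LHS](wE u) linear_sum.
by apply: eq_bigr => i _; rewrite !linearZ u'E.
Qed.

Lemma proj_torsionless P x : fin_gen P -> projective P ->
  (forall w : dual P, w x = 0) -> x = 0.
Proof.
move=> fP pP w0; have [k [y [w [yE _]]]] := dual_basis fP pP.
by rewrite (yE x) big1 // => i _; rewrite w0 scale0r.
Qed.

(** M* embeds in a finite power of R by evaluation at generators of M. *)
Lemma fin_gen_dual M : left_noetherian R^c -> fin_gen M -> fin_gen (dual M).
Proof.
move=> rN /fin_genP[k [x xo]].
have [|f fE] := @linear_exists R^c (dual M) 'rV[R^c]_k (fun w => \row_i (w (x i) : R^c)).
  by move=> a u v; apply/rowP=> i; rewrite !mxE.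
apply: (fin_gen_sub (i := f)) => //; last exact: fin_gen_row.
apply: linear_injective => w; rewrite fE => /rowP w0; apply: dual_ext => y.
have [u uE] := dual_lin w; have [r <-] := xo y.
rewrite -uE /lcomb /= /lcombf linear_sum big1 // => i _.
have := w0 i; rewrite !mxE => e; rewrite linearZ uE e; exact: mulr0.
Qed.

(** The map M -> R^k whose components generate M*. *)
Lemma left_approx M : left_noetherian R^c -> fin_gen M ->
  (forall x : M, (forall w : dual M, w x = 0) -> x = 0) ->
  exists L N (a : {linear M -> L}) (b : {linear L -> N}),
  [/\ fin_gen L, projective L, short_exact a b & forms_extend a].
Proof.
move=> rN fM tl; have /fin_genP[k [w wo]] := fin_gen_dual rN fM.
have [v vE] := choice (fun i => dual_lin (w i)).
have [|a aE] := @linear_exists R M 'rV[R]_k (fun x => \row_i (v i x : R)).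
  by move=> c x y; apply/rowP=> i; rewrite !mxE linearP.
have [N [b [bo bE]]] := cokernel_exists a; exists 'rV[R]_k, N, a, b; split.
- exact: fin_gen_row.
- exact: row_projective.
- split=> //; apply: linear_injective => x; rewrite aE => /rowP x0; apply: tl => u.
  have [r <-] := wo u; rewrite /lcomb /= /lcombf dual_sum big1 // => i _.
  by have := x0 i; rewrite !mxE vE => ->; rewrite mul0r.
- move=> u; have [u' u'E] := lin_dual u; have [r rE] := wo u'.
  exists (lcomb (fun i => r 0 i : R^o)) => x.
  rewrite -u'E -rE /lcomb /= /lcombf dual_sum; apply: eq_bigr => i _.
  by rewrite aE mxE vE.
Qed.

Lemma transpose_exists M : left_noetherian R -> fin_gen M ->
  exists T : lmodType R^c, is_transpose M T.
Proof.
move=> lN fM; have [P0 [e [pP0 fP0 eo]]] := fin_gen_cover fM.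
have [K [i [ii iE]]] := kernel_exists e.
have [P1 [p [pP1 fP1 po]]] := fin_gen_cover (fin_gen_sub lN ii fP0).
have [T [q [qo qE]]] := cokernel_exists (dual_map (lcomp i p)).
exists T, P1, P0, (lcomp i p), e; split=> //; last by exists q.
split=> // y; rewrite iE; split=> [[x <-]|[x <-]]; last by exists (p x).
by have [z <-] := po x; exists z.
Qed.

(** K is the image of P0* -> P1*, the first syzygy of T. Since a left
    approximation M -> L makes L* onto M*, which is the kernel of P0* -> P1*, the
    sequence L* -> P0* -> K -> 0 is exact and dual to P0 -> L -> N -> 0: this is
    the third clause. For the last one, a form on K is by [bidual] evaluation at
    some y in P0 whose image in M is killed by all forms on M; it extends to P1*
    exactly when y comes from P1, that is, when y is 0 in M. *)
Lemma transpose_step M T : is_transpose M T ->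
  exists K S (k : {linear K -> S}) (q : {linear S -> T}),
  [/\ projective S, short_exact k q,
    forall L N (a : {linear M -> L}) (b : {linear L -> N}),
      [/\ fin_gen L, projective L, short_exact a b & forms_extend a] -> is_transpose N K &
    (forall u : {linear K -> R^c^o}, exists v : {linear S -> R^c^o}, forall x, v (k x) = u x)
    <-> (forall x : M, (forall w : dual M, w x = 0) -> x = 0)].
Proof.
move=> [P1 [P0 [f [e [[fP1 pP1] [fP0 pP0] [eo feE] [q [qo qE]]]]]]].
have [K [k [ki kE]]] := kernel_exists q.
have [|g gE] := @lift_through_inj _ _ _ _ k (dual_map f) ki.
  by move=> u; apply/kE/qE; exists u.
have go y : exists u, g u = y.
  have /qE[u uE] : q (k y) = 0 by apply: exact_comp0 kE.
  by exists u; apply: ki; rewrite gE.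
have g0 u : g u = 0 <-> exists w : dual M, dual_map e w = u.
  split=> [gu0|[w <-]].
    have [u' u'E] := dual_lin u.
    have [|w wE] := @factor_through_onto _ _ _ _ e u' eo.
      move=> x /feE[y <-]; rewrite u'E -[LHS]/(dual_map f u y) -gE gu0 linear0 //.
    have [w' w'E] := lin_dual w; exists w'; apply: dual_ext => x.
    by rewrite -u'E -wE -w'E.
  apply: ki; rewrite gE linear0; apply: dual_ext => x.
  rewrite /= (exact_comp0 x feE); have [w' w'E] := dual_lin w; by rewrite -w'E linear0.
exists K, (dual P1), k, q; split=> //.
- exact: dual_projective.
- move=> L N a b [fL pL [ai abE bo] ea].
  exists P0, L, (lcomp a e), b; split=> //.
    split=> // y; rewrite abE; split=> [[x <-]|[x <-]]; last by exists (e x).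
    by have [z <-] := eo x; exists z.
  exists g; split=> // u; rewrite g0; split=> [[w <-]|[v <-]].
    have [w' w'E] := dual_lin w; have [v vE] := ea w'; have [v' v'E] := lin_dual v.
    by exists v'; apply: dual_ext => x; rewrite /= v'E vE w'E.
  by exists (dual_map a v); apply: dual_ext.
- split=> [ext x x0|tl u].
    have [y yx] := eo x.
    have [|u uE] := @factor_through_onto _ _ _ _ g (eval y) go.
      by move=> w /g0[v <-]; rewrite /eval /= /evalf /= yx.
    have [v vE] := ext u; have [z zE] := bidual v fP1 pP1.
    have yz : y = f z.
      apply/subr0_eq/(proj_torsionless fP0 pP0) => w; have [w' w'E] := dual_lin w.
      rewrite -w'E linearB !w'E; apply/eqP; rewrite subr_eq0; apply/eqP.
      by rewrite -[LHS]/(eval y w) -uE -vE zE gE.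
    by rewrite -yx yz; exact: exact_comp0 feE.
  have [y yE] := bidual (lcomp u g) fP0 pP0.
  have /feE[z zy] : e y = 0.
    apply: tl => w; rewrite -[LHS]/(dual_map e w y) -yE /=.
    have -> : g (dual_map e w) = 0 by apply/g0; exists w.
    by rewrite linear0.
  exists (eval z) => x; have [v <-] := go x.
  by rewrite -[RHS]/(lcomp u g v) yE gE /eval /= /evalf /= zy.
Qed.

Lemma torsionfree_ext_zero i M T : torsionfree i M -> is_transpose M T ->
  forall j, (j < i)%N -> ext_zero_some j T R^c^o.
Proof.
elim: i M T => // i IH M T [fM [L [N [a [b [fL pL ab ea tN]]]]]] MT.
have [K [P [k [q [pP kq step tl]]]]] := transpose_step MT.
case=> [|j] ji; exists K, P, k, q; split=> //.
  apply/tl => x x0; have [ai _ _] := ab.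
  apply: (injective_eq0 ai); apply: proj_torsionless => // w.
  exact: (x0 (dual_map a w)).
by apply: (IH N) ji => //; apply: (step L N a b).
Qed.

Lemma ext_zero_torsionfree i M T : left_noetherian R^c -> fin_gen M -> is_transpose M T ->
  (forall j, (j < i)%N -> ext_zero_some j T R^c^o) -> torsionfree i M.
Proof.
move=> rN; elim: i M T => // i IH M T fM MT E; split=> //.
have [K [P [k [q [pP kq step tl]]]]] := transpose_step MT.
have /tl MM := ext_zero_some_all (E 0%N erefl) _ _ _ _ pP kq.
have [L [N [a [b LN]]]] := left_approx rN fM MM; exists L, N, a, b.
case: (LN) => fL pL ab ea; split=> //.
apply: (IH _ K).
- by apply: (fin_gen_onto (f := b)) fL; case: ab.
- exact: (step L N a b).
- move=> j ji; apply: ext_zero_all_some; have Z := ext_zero_some_all (E j.+1 ji).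
  exact: (Z _ _ _ _ pP kq).
Qed.

Lemma class_TP i M : left_noetherian R -> left_noetherian R^c ->
  class_T i M <-> torsionfree i M.
Proof.
move=> lN rN; split=> [[fM [T MT E]]|tM].
  by apply: ext_zero_torsionfree (MT) _ => // j ji; apply/Ext_eq0P; exact: (E j.+1).
have fM := torsionfree_fg tM; have [T MT] := transpose_exists lN fM.
split=> //; exists T => //; case=> // j ji; apply/Ext_eq0P.
exact: torsionfree_ext_zero tM MT _ ji.
Qed.
End Duality.

(** * Divisible abelian groups *)

(** A union of members of a nonempty chain inherits 0 from any of them; the empty
    chain is taken care of by adding [A0] to every member. *)
Lemma zorn_above (T : Type) (P : set T -> Prop) (A0 : set T) : P A0 ->
  (forall F : set (set T), (exists A, F A) -> (forall A, F A -> P A) ->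
    (forall A B, F A -> F B -> (forall x, A x -> B x) \/ (forall x, B x -> A x)) ->
    P (fun x => exists2 A, F A & A x)) ->
  exists A, [/\ P A, forall x, A0 x -> A x &
    forall B, P B -> (forall x, A x -> B x) -> forall x, B x -> A x].
Proof.
move=> P0 chain; pose P' (B : set T) := P (A0 `|` B)%classic.
have [F FP tot|A [PA Amax]] := @Zorn_bigcup T P'.
  change (P (A0 `|` \bigcup_(X in F) X)%classic).
  have [[B FB]|F0] := pselect (exists B, F B); last first.
    suff -> : (A0 `|` \bigcup_(X in F) X = A0)%classic by [].
    by apply/seteqP; split=> x; [case=> // [[B FB]]; case: F0; exists B | left].
  pose F' : set (set T) := fun C => exists2 B, F B & C = (A0 `|` B)%classic.
  suff -> : (A0 `|` \bigcup_(X in F) X)%classic = fun x => exists2 A, F' A & A x.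
    apply: chain; first by exists (A0 `|` B)%classic, B.
      by move=> _ [C FC ->]; exact: FP.
    move=> _ _ [C FC ->] [E FE ->].
    by case: (tot _ _ FC FE) => s; [left|right] => x [Ax|Cx];
      [left|right; exact: s|left|right; exact: s].
  apply/seteqP; split=> x.
    case=> [Ax|[C FC Cx]]; first by exists (A0 `|` B)%classic; [exists B|left].
    by exists (A0 `|` C)%classic; [exists C|right].
  by case=> _ [C FC ->] [Ax|Cx]; [left|right; exists C].
exists (A0 `|` A)%classic; split=> // [x|B PB AB x Bx]; first by left.
have [AeB|AB'] := pselect (B `<=` A)%classic; first by right; apply: AeB.
case: (Amax B); last first.
  change (P (A0 `|` B)%classic); suff -> : (A0 `|` B)%classic = B by [].
  by apply/seteqP; split=> y; [case=> // Ay; apply: AB; left | right].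
by split=> // y Ay; apply: AB; right.
Qed.

Lemma subr_interchange (V : zmodType) (x y z t : V) : x - y - (z - t) = x - z - (y - t).
Proof. by rewrite !opprB addrACA [RHS]addrACA [- y - z]addrC. Qed.

Definition additive_fun (A B : zmodType) (f : A -> B) := forall x y, f (x - y) = f x - f y.

Lemma additive_fun0 (A B : zmodType) (f : A -> B) : additive_fun f -> f 0 = 0.
Proof. by move=> af; rewrite -[0 in LHS](subrr 0) af subrr. Qed.

Lemma additive_funD (A B : zmodType) (f : A -> B) x y : additive_fun f -> f (x + y) = f x + f y.
Proof.
by move=> af; rewrite -[y in LHS]opprK -[- y]sub0r !af (additive_fun0 af) sub0r opprK.
Qed.

Definition divisible (D : zmodType) := forall n (d : D), exists e, e *+ n.+1 = d.

(** Partial additive maps from B to D are handled as their graphs, so that the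
    union of a chain is again one. *)
Definition partial_additive (B D : zmodType) (G : set (B * D)) :=
  [/\ G (0, 0), forall b d b' d', G (b, d) -> G (b', d') -> G (b - b', d - d')
    & forall d, G (0, d) -> d = 0].

Lemma partial_additive_fun (B D : zmodType) (G : set (B * D)) b d d' :
  partial_additive G ->
  G (b, d) -> G (b, d') -> d = d'.
Proof.
move=> [_ GB G0] Gd Gd'; apply/subr0_eq/G0.
by have := GB _ _ _ _ Gd Gd'; rewrite subrr.
Qed.

Lemma partial_additiveMn (B D : zmodType) (G : set (B * D)) b d n : partial_additive G ->
  G (b, d) -> G (b *+ n, d *+ n).
Proof.
move=> [G0 GB _] Gb; elim: n => [|n IH]; first by rewrite !mulr0n.
have Gn : G (- (b *+ n), - (d *+ n)) by rewrite -sub0r -[- (d *+ n)]sub0r; exact: GB.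
by have := GB _ _ _ _ Gb Gn; rewrite !opprK -!mulrS.
Qed.

(** If some positive multiple of b is in the domain, let k + 1 be the least one;
    then d is a (k + 1)-th fraction of the value there, and division with
    remainder shows that it is compatible with all other multiples of b. *)
Lemma partial_additive_step (B D : zmodType) (G : set (B * D)) b :
  divisible D -> partial_additive G ->
  exists d G', [/\ partial_additive G', (forall x, G x -> G' x) & G' (b, d)].
Proof.
move=> divD pG; have [G0 GB Gf] := pG.
have GN c e : G (c, e) -> G (- c, - e).
  by move=> Gc; rewrite -sub0r -[- e]sub0r; exact: GB.
pose dom n := `[< exists e, G (b *+ n.+1, e) >].
have [d dE] : exists d, forall n e, G (b *+ n, e) -> e = d *+ n.
  have [[m mdom]|nd] := pselect (exists m, dom m); last first.
    exists 0 => -[|n] e; rewrite ?mulr0n; first exact: Gf.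
    by move=> Ge; case: nd; exists n; apply/asboolP; exists e.
  have exm : exists m, dom m by exists m.
  case: (ex_minnP exm) => k /asboolP[e Ge] kmin.
  have [d de] := divD k e; exists d => n c Gc.
  have Gq := partial_additiveMn (n %/ k.+1) pG Ge.
  have Gr : G (b *+ (n %% k.+1), c - e *+ (n %/ k.+1)).
    have := GB _ _ _ _ Gc Gq; rewrite -mulrnA {1}(divn_eq n k.+1) mulnC mulrnDr.
    by rewrite addrAC subrr add0r.
  (* by minimality of k the remainder is not a smaller positive multiple *)
  have r0 : (n %% k.+1 = 0)%N.
    have lt := ltn_pmod n (ltn0Sn k); case E : (n %% k.+1)%N Gr lt => [|r] // Gr lt.
    have /kmin : dom r by apply/asboolP; eexists; exact: Gr.
    by rewrite leqNgt -ltnS lt.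
  move: Gr; rewrite r0 mulr0n => /Gf/subr0_eq ->.
  by rewrite -de -mulrnA mulnC {2}(divn_eq n k.+1) r0 addn0.
pose G' (x : B * D) := exists n : int, G (x.1 - b *~ n, x.2 - d *~ n).
exists d, G'; split.
- split=> [|b1 d1 b2 d2 [n /= Gn] [m /= Gm]|e [n /=]].
  + by exists 0; rewrite /= !mulr0z !subr0.
  + exists (n - m); rewrite /= !mulrzBr.
    by rewrite (subr_interchange b1) (subr_interchange d1); exact: GB.
  + rewrite sub0r; case: n => n.
      move=> /GN; rewrite !opprB !opprK => /dE/eqP.
      by rewrite -pmulrn -subr_eq0 addrAC subrr sub0r oppr_eq0 => /eqP.
    rewrite NegzE !mulrNz !opprK => /dE/eqP.
    by rewrite -subr_eq0 addrK => /eqP.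
- by move=> [c e] Gx; exists 0; rewrite /= !mulr0z !subr0.
- by exists 1; rewrite /= !mulr1z !subrr.
Qed.

(** Divisible groups are injective: a maximal partial extension is total. *)
Lemma divisible_extend (A B D : zmodType) (f : A -> B) (g : A -> D) : divisible D ->
  additive_fun f -> additive_fun g -> injective f ->
  exists2 h : B -> D, additive_fun h & forall x, h (f x) = g x.
Proof.
move=> divD af ag fi; pose G0 (x : B * D) := exists a, x = (f a, g a).
have [|F [G FG] FP tot|G [pG G0G Gmax]] := @zorn_above _ (@partial_additive B D) G0.
- split=> [|_ _ _ _ [a [-> ->]] [a' [-> ->]]|d [a [e ->]]].
  + by exists 0; rewrite (additive_fun0 af) (additive_fun0 ag).
  + by exists (a - a'); rewrite af ag.
  + by rewrite (_ : a = 0) ?(additive_fun0 ag) //; apply: fi; rewrite -e (additive_fun0 af).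
- split=> [|b d b' d' [H FH Hx] [K FK Kx]|d [H FH Hx]].
  + by exists G => //; case: (FP _ FG).
  + have [s|s] := tot _ _ FH FK.
      by exists K => //; have [_ KB _] := FP _ FK; apply: KB => //; exact: s.
    by exists H => //; have [_ HB _] := FP _ FH; apply: HB => //; exact: s.
  + by have [_ _] := FP _ FH; apply.
have tot b : exists d, G (b, d).
  have [d [G' [pG' GG' G'd]]] := partial_additive_step b divD pG.
  by exists d; exact: Gmax GG' _ G'd.
have [h hE] := choice tot; exists h => [x y|x].
  have [_ GB _] := pG; apply: partial_additive_fun pG (hE _) _; exact: GB.
by apply: partial_additive_fun pG (hE _) _; apply: G0G; exists x.
Qed.

(** An abelian group M is Z^(M) / K for the group K of integral relations between
    its elements; it embeds in the divisible group Q^(M) / K. *)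
Lemma divisible_hull (M : zmodType) :
  exists (D : zmodType) (i : M -> D), [/\ divisible D, additive_fun i & injective i].
Proof.
pose W : lmodType int := copies M (zmodule rat).
pose K (f : W) := exists s (n : M -> int), [/\ uniq s, forall x, x \notin s -> n x = 0,
  forall x, f x = (n x)%:~R :> rat & \sum_(x <- s) x *~ n x = 0].
have sK : submodule K.
  split.
    by exists [::], (fun=> 0); split; rewrite ?big_nil.
  move=> a f g [s [n [us s0 fE sn]]] [t [m [ut t0 gE tm]]].
  have u := undup_uniq (s ++ t).
  have v0 x : x \notin undup (s ++ t) -> n x = 0 /\ m x = 0.
    by rewrite mem_undup mem_cat negb_or => /andP[/s0 ? /t0 ?].
  exists (undup (s ++ t)), (fun x => a * n x + m x); split=> //.
  - by move=> x /v0[-> ->]; rewrite mulr0 addr0.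
  - move=> x; change ((f x : rat) *~ a + (g x : rat) = (a * n x + m x)%:~R).
    by rewrite fE gE intrD intrM -mulrzl.
  have e (c : M -> int) r : uniq r -> (forall x, x \notin r -> c x = 0) ->
      (forall x, x \notin undup (s ++ t) -> c x = 0) ->
      \sum_(x <- undup (s ++ t)) x *~ c x = \sum_(x <- r) x *~ c x.
    by move=> ur r0 c0; apply: (@big_support int M (zmodule M)) => // x xr;
      [rewrite c0|rewrite r0]; rewrite ?mulr0z.
  under eq_bigr do rewrite mulrzDr mulrC mulrzA.
  rewrite big_split /= -mulrz_suml (e n s) // => [|x /v0[]//].
  by rewrite (e m t) // => [|x /v0[]//]; rewrite sn tm mul0rz addr0.
have [C [p [po pK]]] := quotient_exists sK.
have /choice[d dE] : forall m : M, exists f : W, forall x, f x = (x == m)%:R :> rat.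
  move=> m; have [f fE] := @copies_finite int M (zmodule rat) [:: m] (fun=> 1 : rat).
  by exists f => x; rewrite fE inE; case: eqP.
exists C, (p \o d); split.
- move=> n c; have [f fc] := po c; have [s [us s0]] := copies_support f.
  have [g gE] := @copies_finite int M (zmodule rat) s (fun x => (f x : rat) / n.+1%:R).
  exists (p g); rewrite -fc -raddfMn; congr (p _); apply: copies_ext => x.
  rewrite -[LHS]/(copies_coord (zmodule rat) x _) raddfMn /= /copies_coordf gE.
  case: ifPn => [_|/s0 ->].
    change (((f x : rat) / n.+1%:R) *+ n.+1 = f x).
    by rewrite -mulr_natr divfK // Num.Theory.pnatr_eq0.
  by rewrite mul0rn.
- move=> x y /=; rewrite -linearB; apply/subr0_eq; rewrite -linearB; apply/pK.
  pose n z : int := (z == x - y)%:R - (z == x)%:R + (z == y)%:R.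
  have [s us ms] : exists2 s : seq M, uniq s & s =i [:: x - y; x; y].
    by exists (undup [:: x - y; x; y]); [exact: undup_uniq | exact: mem_undup].
  exists s, n; split=> //.
  + move=> z; rewrite ms !inE !negb_or => /and3P[/negbTE e1 /negbTE e2 /negbTE e3].
    by rewrite /n e1 e2 e3.
  + move=> z; change ((d (x - y) z : rat) - ((d x z : rat) - (d y z : rat)) = (n z)%:~R).
    by rewrite !dE /n intrD intrB !mulrz_nat opprB addrA addrAC.
  + have e (m : M) : m \in s -> \sum_(z <- s) z *~ (z == m)%:R = m.
      move=> mS; rewrite (bigD1_seq m) //= eqxx big1 ?addr0 // => z /negbTE ->.
      exact: mulr0z.
    under eq_bigr do rewrite mulrzDr mulrzBr.
    rewrite big_split sumrB /= !e ?ms ?inE ?eqxx ?orbT //.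
    by rewrite addrAC subrK subrr.
- move=> x y /= /eqP; rewrite -subr_eq0 -linearB => /eqP/pK[s [n [us s0 nE ns]]].
  have nE' z : n z = (z == x)%:R - (z == y)%:R.
    apply: (@intr_inj rat); rewrite -nE intrB !mulrz_nat -!dE //.
  apply/eqP; rewrite -subr_eq0; apply/eqP.
  have e (m : M) : \sum_(z <- undup [:: x, y & s]) z *~ (z == m)%:R =
      if m \in undup [:: x, y & s] then m else 0.
    case: ifP => ms.
      rewrite (bigD1_seq m) ?undup_uniq //= eqxx big1 ?addr0 // => z /negbTE ->.
      exact: mulr0z.
    rewrite big1_seq // => z /andP[_ zs]; case: eqP => [zm|]; last by rewrite mulr0z.
    by rewrite -zm zs in ms.
  have : \sum_(z <- undup [:: x, y & s]) z *~ n z = 0.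
    rewrite -[RHS]ns; apply: (@big_support int M (zmodule M)); rewrite ?undup_uniq //.
      by move=> z; rewrite mem_undup !inE !negb_or => /and3P[_ _ /s0 ->]; rewrite mulr0z.
    by move=> z /s0 ->; rewrite mulr0z.
  under eq_bigr do rewrite nE' mulrzBr.
  by rewrite sumrB !e !mem_undup !inE !eqxx !orbT.
Qed.

(** * Injective envelopes and minimal injective resolutions *)

Section Coinduced.
Variables (R : pzRingType) (D : zmodType).

(** Hom_Z(R, D), with the left action (a f) x = f (x a). *)
Definition is_additive_fun : {pred R -> D} := fun f => `[< additive_fun f >].
Lemma is_additive_fun_zmod : zmod_closed is_additive_fun.
Proof.
split=> [|f g /asboolP Lf /asboolP Lg]; apply/asboolP => x y.
  by rewrite [RHS]subr0.
change (f (x - y) - g (x - y) = (f x - g x) - (f y - g y)).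
by rewrite Lf Lg subr_interchange.
Qed.
HB.instance Definition _ :=
  GRing.isZmodClosed.Build (R -> D) is_additive_fun is_additive_fun_zmod.

Record coind := Coind { coind_val :> R -> D; _ : coind_val \in is_additive_fun }.
HB.instance Definition _ := [isSub for coind_val].
HB.instance Definition _ := [Choice of coind by <:].
HB.instance Definition _ := [SubChoice_isSubZmodule of coind by <:].

Lemma coindB (f : coind) x y : f (x - y) = f x - f y.
Proof. by case: f => f /= /asboolP; exact. Qed.
Lemma coindD (f : coind) x y : f (x + y) = f x + f y.
Proof.
by apply: additive_funD; exact: coindB.
Qed.

Lemma coind_scale_subproof (a : R) (f : coind) : (fun x => f (x * a)) \in is_additive_fun.
Proof. by apply/asboolP=> x y; rewrite mulrBl coindB. Qed.
Definition coind_scale a f := Coind (coind_scale_subproof a f).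
Lemma coind_ext (f g : coind) : f =1 g -> f = g.
Proof. by move=> /funext e; apply: val_inj. Qed.

Lemma coind_A a b f : coind_scale a (coind_scale b f) = coind_scale (a * b) f.
Proof. by apply: coind_ext => x /=; rewrite mulrA. Qed.
Lemma coind_1 : left_id 1 coind_scale.
Proof. by move=> f; apply: coind_ext => x /=; rewrite mulr1. Qed.
Lemma coind_Dr : right_distributive coind_scale +%R.
Proof. by move=> a f g; apply: coind_ext. Qed.
Lemma coind_Dl f : {morph coind_scale^~ f : a b / a + b}.
Proof. by move=> a b; apply: coind_ext => x /=; rewrite mulrDr coindD. Qed.
HB.instance Definition _ :=
  GRing.Zmodule_isLmodule.Build R coind coind_A coind_1 coind_Dr coind_Dl.

(** Linear maps B -> Hom_Z(R, D) correspond to additive maps B -> D by evaluation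
    at 1, and those extend since D is divisible. *)
Lemma coind_injective : divisible D -> injective_mod (coind : lmodType R).
Proof.
move=> divD A B f g fi.
have [|||h ah hE] := @divisible_extend A B D f (fun x => g x 1) divD.
- by move=> x y; rewrite linearB.
- by move=> x y; rewrite linearB.
- by [].
have F b : (fun s => h (s *: b)) \in is_additive_fun.
  by apply/asboolP=> x y; rewrite scalerBl ah.
have [|H HE] := @linear_exists R B coind (fun b => Coind (F b)).
  move=> a x y; apply: coind_ext => s /=.
  change (h (s *: (a *: x + y)) = h ((s * a) *: x) + h (s *: y)).
  by rewrite scalerDr scalerA (additive_funD _ _ ah).
exists H => x; apply: coind_ext => s; rewrite HE /= -linearZ hE linearZ /=.
by rewrite -[LHS]/(g x (1 * s)) mul1r.
Qed.
End Coinduced.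

Section Hulls.
Variable R : pzRingType.
Implicit Types A B C D E H K M N P : lmodType R.

Lemma enough_injectives M : exists E (a : {linear M -> E}), injective_mod E /\ injective a.
Proof.
have [D [i [divD ai ii]]] := divisible_hull M.
have F m : (fun s : R => i (s *: m)) \in @is_additive_fun R D.
  by apply/asboolP=> x y; rewrite scalerBl ai.
have [|f fE] := @linear_exists R M (coind R D) (fun b => Coind (F b)).
  move=> a x y; apply: coind_ext => s /=.
  change (i (s *: (a *: x + y)) = i ((s * a) *: x) + i (s *: y)).
  by rewrite scalerDr scalerA (additive_funD _ _ ai).
exists (coind R D), f; split; first exact: coind_injective.
move=> x y; rewrite !fE => /(congr1 (fun h : coind R D => h 1)) /= /ii.
by rewrite !scale1r.
Qed.

(** It suffices to test cyclic submodules. *)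
Lemma essentialP A B (f : {linear A -> B}) : essential f <->
  forall y, y != 0 -> exists r x, r *: y = f x /\ f x != 0.
Proof.
split=> [ess y y0|ess U Uf y Uy].
  apply: contrapT => nx; have sS : submodule (fun z => exists r, z = r *: y).
    split=> [|a _ _ [r ->] [s ->]]; first by exists 0; rewrite scale0r.
    by exists (a * r + s); rewrite scalerDl scalerA.
  have [U UE] := submodule_closed sS; move/eqP: y0; apply; apply: (ess U).
    move=> x /UE[r e]; apply/eqP; apply: contrapT => fx; apply: nx.
    by exists r, x; split; [rewrite e | apply/negP].
  by apply/UE; exists 1; rewrite scale1r.
apply/eqP; apply: contrapT => /negP/ess[r [x [e fx]]].
by move/eqP: fx; apply; apply: Uf; rewrite -e rpredZ.
Qed.

Lemma injective_mod_retract E M (s : {linear M -> E}) (r : {linear E -> M}) :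
  injective_mod E -> (forall x, r (s x) = x) -> injective_mod M.
Proof.
move=> iE rs A B f g fi; have [h hE] := iE _ _ f (lcomp s g) fi.
by exists (lcomp r h) => x /=; rewrite hE /= rs.
Qed.

Lemma submodule_chain M (F : set (set M)) :
  (exists X, F X) -> (forall X, F X -> submodule X) ->
  (forall X Y, F X -> F Y -> (forall x, X x -> Y x) \/ (forall x, Y x -> X x)) ->
  submodule (fun x => exists2 X, F X & X x).
Proof.
move=> [G FG] FP tot; split=> [|a x y [A FA Ax] [B FB By]].
  by exists G => //; case: (FP _ FG).
have [s|s] := tot _ _ FA FB; [exists B|exists A] => //.
  by apply: (FP _ FB).2 => //; exact: s.
by apply: (FP _ FA).2 => //; exact: s.
Qed.

(** In an injective E containing M, let S be a maximal essential extension of M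
    and K a maximal submodule with K and S disjoint. Then E/K is an essential
    extension of S, so the map E/K -> E that extends the inclusion of S is
    injective with image an essential extension of M containing S, hence S
    itself. Thus E -> E/K -> S is a retraction, and S is injective. *)
Lemma hull_exists M : exists E (a : {linear M -> E}),
  [/\ injective_mod E, injective a & essential a].
Proof.
have [E [a [iE ai]]] := enough_injectives M.
pose ess (S : set E) := submodule S /\ forall y, S y -> y != 0 ->
  exists r x, r *: y = a x /\ a x != 0.
have [||S [[sS essS] aS Smax]] := @zorn_above _ ess (range_of a).
- split; first exact: submodule_range.
  by move=> _ [x <-] nz; exists 1, x; rewrite scale1r.
- move=> F ex FP tot; split.
    by apply: submodule_chain => // A /FP[].
  by move=> y [A /FP[_ e] Ay]; exact: e.
pose disj (K : set E) := submodule K /\ forall y, K y -> S y -> y = 0.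
have [||K [[sK dK] _ Kmax]] := @zorn_above _ disj (fun x => x = 0).
- split=> //; split=> // b x y -> ->; by rewrite scaler0 addr0.
- move=> F ex FP tot; split.
    by apply: submodule_chain => // A /FP[].
  by move=> y [A /FP[_ e] Ay]; exact: e.
have [H [i [ii iE']]] := submodule_exists sS.
have [Q [q [qo qE]]] := quotient_exists sK.
have qi : injective (lcomp q i).
  apply: linear_injective => x /qE Kx; apply: (injective_eq0 ii); apply: dK => //.
  by apply/iE'; exists x.
have [th thE] := iE _ _ (lcomp q i) i qi.
have SQ y : q y != 0 -> exists r h, [/\ r *: q y = q h, S h & h != 0].
  move=> qy; apply: contrapT => nx.
  (* by maximality of K, the submodule K + R y meets S *)
  pose K' : set E := fun z => exists r k, K k /\ z = r *: y + k.
  have K'd : disj K'.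
    split; first split=> [|b _ _ [r [k [Kk ->]]] [r' [k' [Kk' ->]]]].
    - by exists 0, 0; split; [exact: sK.1 | rewrite scale0r addr0].
    - exists (b * r + r'), (b *: k + k'); split; first exact: sK.2.
      by rewrite scalerDr scalerDl scalerA addrACA.
    move=> z [r [k [Kk zE]]] Sz; apply/eqP; apply: contrapT => /negP z0; apply: nx.
    exists r, z; split=> //; rewrite zE linearD linearZ.
    by have /qE -> := Kk; rewrite addr0.
  move/eqP: qy; apply; apply/qE; apply: (Kmax K' K'd).
    by move=> x Kx; exists 0, x; rewrite scale0r add0r.
  by exists 1, 0; split; [exact: sK.1 | rewrite scale1r addr0].
have thq h : S h -> th (q h) = h.
  by move=> /iE'[x <-]; exact: thE.
have thS z : S (th z).
  apply: (Smax (range_of th)); last by exists z.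
    split; first exact: submodule_range.
    move=> _ [w <-] tw; have [y yw] := qo w; rewrite -yw in tw *.
    have [|r [h [e Sh h0]]] := SQ y.
      by apply: contraNneq tw => ->; rewrite linear0.
    have [s [x [sx ax]]] := essS _ Sh h0; exists (s * r), x; split=> //.
    by rewrite -scalerA -linearZ e thq.
  by move=> h Sh; exists (q h); exact: thq.
have [|rr rrE] := @lift_through_inj _ _ _ _ i (lcomp th q) ii.
  by move=> x; apply/iE'; exact: thS.
have [|b bE] := @lift_through_inj _ _ _ _ i a ii.
  by move=> x; apply/iE'/aS; exists x.
exists H, b; split.
- apply: (injective_mod_retract (s := i) (r := rr)) => // x.
  by apply: ii; rewrite rrE /= thq //; apply/iE'; exists x.
- by move=> x y e; apply: ai; rewrite -!bE e.
- apply/essentialP => y y0; have iy : i y != 0.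
    by apply: contraNneq y0 => e; apply/eqP; exact: (injective_eq0 ii).
  have [|r [x [e ax]]] := essS (i y) _ iy; first by apply/iE'; exists y.
  exists r, x; split; first by apply: ii; rewrite bE -e; exact: linearZ.
  by apply: contraNneq ax => b0; rewrite -bE b0 linear0.
Qed.

(** One record for the same reason as [cover]. *)
Record hull M := Hull { h_E : lmodType R; h_N : lmodType R;
  h_a : {linear M -> h_E}; h_b : {linear h_E -> h_N};
  h_inj : injective_mod h_E; h_ess : essential h_a; h_ses : short_exact h_a h_b }.

Lemma hull_inhabited M : exists h : hull M, True.
Proof.
have [E [a [iE ai ea]]] := hull_exists M; have [N [b [bo bE]]] := cokernel_exists a.
have ab : short_exact a b by [].
by exists (Hull iE ea ab).
Qed.
Definition some_hull M : hull M := projT1 (cid (hull_inhabited M)).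

Fixpoint hull_cosyz M k : lmodType R :=
  if k is k'.+1 then h_N (some_hull (hull_cosyz M k')) else M.

Definition some_min_inj_resolution M : min_inj_resolution M.
Proof.
pose c k := some_hull (hull_cosyz M k).
pose d k : {linear h_E (c k) -> h_E (c k.+1)} := lcomp (h_a (c k.+1)) (h_b (c k)).
have bE k y : h_b (c k) y = 0 <-> d k y = 0.
  rewrite /d /=; split=> [->|]; first by rewrite linear0.
  by have [ai _ _] := h_ses (c k.+1); apply: injective_eq0.
refine (@MinInjResolution R M (fun k => h_E (c k)) (h_a (c 0%N)) d _ _ _ _ _ _).
- by case: (h_ses (c 0%N)).
- by move=> y; rewrite -bE; case: (h_ses (c 0%N)).
- move=> k y; rewrite -bE; have [_ abE _] := h_ses (c k.+1); have [_ _ bo] := h_ses (c k).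
  rewrite abE; split=> [[x <-]|[x <-]]; last by exists (h_b (c k) x).
  by have [z <-] := bo x; exists z.
- by move=> k; exact: h_inj.
- exact: h_ess.
- move=> k; apply/essentialP => y y0.
  have /essentialP : essential (h_a (c k.+1)) by exact: h_ess.
  move=> /(_ y y0)[r [x [e nz]]]; have [_ _ bo] := h_ses (c k).
  by have [z zx] := bo x; exists r, z; rewrite /d /= zx.
Defined.
End Hulls.

(** * Summands of direct sums of copies *)

Lemma inj_onto_bij (S T : Type) (f : S -> T) : injective f -> onto f -> bijective f.
Proof.
move=> fi fo; have [g gE] := choice fo; exists g => // x.
by apply: fi; rewrite gE.
Qed.

Lemma finite_set_comp (T U : Type) (f : T -> U) (Q : set U) : injective f ->
  finite_set Q -> finite_set (fun x => Q (f x)).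
Proof. by move=> fi; apply: finite_preimage => x y _ _; exact: fi. Qed.

Section Summands.
Variable R : pzRingType.
Implicit Types A B C D E H K M N P : lmodType R.

Definition retract M N :=
  exists (s : {linear M -> N}) (r : {linear N -> M}), forall x, r (s x) = x.

Lemma retract_refl M : retract M M.
Proof. by exists (lid M), (lid M). Qed.

Lemma retract_trans M N P : retract M N -> retract N P -> retract M P.
Proof.
move=> [s [r rs]] [s' [r' rs']]; exists (lcomp s' s), (lcomp r r') => x /=.
by rewrite rs' rs.
Qed.

Lemma retract_inl M N : retract M (M * N)%type.
Proof. by exists (linl M N), (lfst M N). Qed.
Lemma retract_inr M N : retract N (M * N)%type.
Proof. by exists (linr M N), (lsnd M N). Qed.

Lemma retract_prod M N M' N' :
  retract M N -> retract M' N' -> retract (M * M')%type (N * N')%type.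
Proof.
move=> [s [r rs]] [s' [r' rs']].
exists (lpair (lcomp s (lfst M M')) (lcomp s' (lsnd M M'))).
exists (lpair (lcomp r (lfst N N')) (lcomp r' (lsnd N N'))) => -[x y] /=.
by rewrite /lpairf /= rs rs'.
Qed.

(** Retracts compose without producing complements, unlike the summands of
    [isom_to_summand]. *)
Lemma isom_to_summandP M N : isom_to_summand M N <-> retract M N.
Proof.
split=> [[M' [f fb]]|[s [r rs]]].
  have [g fK gK] := fb; have [|h hE] := @lift_through_inj _ _ _ _ f (lid N) (can_inj fK).
    by move=> x; exists (g x); rewrite gK.
  exists (lcomp f (linl M M')), (lcomp (lfst M M') h) => x /=.
  suff -> : h (f (lpairf (lid M) (lzero M M') x)) = lpairf (lid M) (lzero M M') x by [].
  by apply: (can_inj fK); rewrite hE.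
have [K [i [ii iE]]] := kernel_exists r; exists K.
exists (ladd (lcomp s (lfst M K)) (lcomp i (lsnd M K))); apply: inj_onto_bij.
  apply: linear_injective => -[x k] /= e.
  have x0 : x = 0.
    by move/(congr1 r): e; rewrite linearD rs (exact_comp0 k iE) linear0 addr0.
  by move: e; rewrite x0 linear0 add0r => /(injective_eq0 ii) ->.
move=> y; have /iE[k kE] : r (y - s (r y)) = 0 by rewrite linearB rs subrr.
by exists (r y, k); rewrite /= kE addrC subrK.
Qed.

Lemma lin_copies (X : Type) A B (F : A -> X -> B) : (forall x, linear (F^~ x)) ->
  (forall a, finite_set [set x | F a x != 0]%classic) ->
  exists G : {linear A -> copies X B}, forall a x, G a x = F a x.
Proof.
move=> Fl Ff; have S a : F a \in @finsupp R X B by apply/asboolP.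
have [|G GE] := @linear_exists R A (copies X B) (fun a => Copies (S a)).
  by move=> c x y; apply: copies_ext => z; exact: Fl.
by exists G => a x; rewrite GE.
Qed.

Lemma copies_fin (X : Type) M (f : copies X M) : finite_set [set x | f x != 0]%classic.
Proof. by case: f => f /= /asboolP. Qed.

Lemma retract_copies (X : Type) M N : retract M N -> retract (copies X M) (copies X N).
Proof.
have map A B (g : {linear A -> B}) :
    exists G : {linear copies X A -> copies X B}, forall f x, G f x = g (f x).
  apply: (@lin_copies X (copies X A) B (fun f x => g (f x))) => [x c f f'|f].
    by rewrite -linearP.
  apply: sub_finite_set (copies_fin f) => x /=; apply: contraNneq => ->.
  by rewrite linear0.
move=> [s [r rs]]; have [S SE] := map _ _ s; have [T TE] := map _ _ r.
by exists S, T => f; apply: copies_ext => x; rewrite TE SE rs.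
Qed.

Lemma retract_copies_unit M : retract M (copies unit M).
Proof.
have [|a|G GE] := @lin_copies unit M M (fun m _ => m).
- by [].
- by apply: (sub_finite_set (B := [set tt]%classic)); [case | exact: finite_set1].
by exists G, (copies_coord M tt) => x; rewrite /= /copies_coordf GE.
Qed.

Lemma retract_copies_prod (X Y : Type) M :
  retract (copies X M * copies Y M)%type (copies (X + Y)%type M).
Proof.
have [||S SE] := @lin_copies (X + Y)%type (copies X M * copies Y M)%type M
    (fun f z => match z with inl x => f.1 x | inr y => f.2 y end).
- by case.
- move=> [f g]; apply: (sub_finite_set (B :=
    (inl @` [set x | f x != 0] `|` inr @` [set x | g x != 0])%classic)).
    by case=> x /= nz; [left|right]; exists x.
  by rewrite finite_setU; split; apply: finite_image; exact: copies_fin.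
have [||r1 r1E] := @lin_copies X (copies (X + Y)%type M) M (fun f x => f (inl x)).
- by [].
- by move=> f; apply: (finite_set_comp (f := inl)) (copies_fin f) => x y [].
have [||r2 r2E] := @lin_copies Y (copies (X + Y)%type M) M (fun f x => f (inr x)).
- by [].
- by move=> f; apply: (finite_set_comp (f := inr)) (copies_fin f) => x y [].
exists S, (lpair r1 r2) => -[f g] /=; rewrite /lpairf.
by congr (_, _); apply: copies_ext => x; rewrite ?r1E ?r2E SE.
Qed.

Lemma retract_copies_copies (X Y : Type) M :
  retract (copies X (copies Y M)) (copies (X * Y)%type M).
Proof.
have [||S SE] := @lin_copies (X * Y)%type (copies X (copies Y M)) M (fun f z => f z.1 z.2).
- by [].
- move=> f; apply: (sub_finite_set (B :=
    (\bigcup_(x in [set x | f x != 0]) (pair x @` [set y | f x y != 0]))%classic)).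
    case=> x y /= nz; exists x; last by exists y.
    by apply: contraNneq nz => ->.
  by apply: bigcup_finite => [|x _]; [|apply: finite_image]; exact: copies_fin.
have inner (f : copies (X * Y)%type M) x : (fun y => f (x, y)) \in @finsupp R Y M.
  by apply/asboolP; apply: (finite_set_comp (f := pair x)) (copies_fin f) => y z [].
have [||T TE] := @lin_copies X (copies (X * Y)%type M) (copies Y M)
    (fun f x => Copies (inner f x)).
- by move=> x c f g; apply: copies_ext.
- move=> f; apply: (sub_finite_set (B := (fst @` [set z | f z != 0])%classic)).
    move=> x /= nz; apply: contrapT => ne; move/eqP: nz; apply.
    apply: copies_ext => y /=; apply/eqP; apply: contrapT => /negP fz; apply: ne.
    by exists (x, y).
  by apply: finite_image; exact: copies_fin.
by exists S, T => f; apply: copies_ext => x; apply: copies_ext => y; rewrite TE /= SE.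
Qed.

(** Add(J_0 + ... + J_s). *)
Definition Add (J : nat -> lmodType R) s E :=
  exists X : Type, retract E (copies X (dsum_le J s)).

Lemma Add_retract J s E E' : retract E E' -> Add J s E' -> Add J s E.
Proof. by move=> EE' [X E'X]; exists X; exact: retract_trans E'X. Qed.

Lemma Add_prod J s E E' : Add J s E -> Add J s E' -> Add J s (E * E')%type.
Proof.
move=> [X EX] [Y EY]; exists (X + Y)%type.
exact: retract_trans (retract_prod EX EY) (retract_copies_prod _ _ _).
Qed.

Lemma Add_mono J s E : Add J s E -> Add J s.+1 E.
Proof.
move=> [X EX]; exists X; apply: retract_trans EX _; apply: retract_copies.
exact: retract_inl.
Qed.

Lemma Add_self J s : Add J s (J s).
Proof.
exists unit; apply: retract_trans (retract_copies_unit _); case: s => [|s].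
  exact: retract_refl.
exact: retract_inr.
Qed.

(** Allows the minimal injective resolution of R to be replaced by another. *)
Lemma Add_trans J J' s E : (forall l, Add J l (J' l)) -> Add J' s E -> Add J s E.
Proof.
move=> JJ' [X EX].
have [Y DY] : Add J s (dsum_le J' s).
  elim: s {E X EX} => [|s IH]; first exact: JJ'.
  by apply: Add_prod; [exact: Add_mono | exact: JJ'].
exists (X * Y)%type; apply: retract_trans EX _.
exact: retract_trans (retract_copies X DY) (retract_copies_copies _ _ _).
Qed.
End Summands.

(** * Injective copresentations and the class R *)

Section Coresolutions.
Variable R : pzRingType.
Implicit Types A B C D E H K M N P : lmodType R.

Lemma injective_prod E E' :
  injective_mod E -> injective_mod E' -> injective_mod (E * E')%type.
Proof.
move=> iE iE' A B f g fi.
have [h hE] := iE _ _ f (lcomp (lfst E E') g) fi.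
have [h' h'E] := iE' _ _ f (lcomp (lsnd E E') g) fi.
by exists (lpair h h') => x /=; rewrite /lpairf hE h'E /=; case: (g x).
Qed.

Lemma injective_zero E : (forall x : E, x = 0) -> injective_mod E.
Proof. by move=> E0 A B f g _; exists (lzero _ _) => x; rewrite [RHS]E0. Qed.

Variable J : nat -> lmodType R.

(** M has an injective resolution, not necessarily minimal, whose first i terms lie
    in Add J s, ..., Add J (s + i - 1). The shift s appears because passing to
    the cokernel of the first map moves the indices by one. *)
Fixpoint copresented (i s : nat) M : Prop :=
  if i is i'.+1 then exists E N (a : {linear M -> E}) (b : {linear E -> N}),
    [/\ injective_mod E, Add J s E, short_exact a b & copresented i' s.+1 N]
  else True.

Lemma copresented_mono i s M : copresented i s M -> copresented i s.+1 M.
Proof.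
elim: i s M => // i IH s M [E [N [a [b [iE AE ab RN]]]]].
by exists E, N, a, b; split; [| exact: Add_mono | |apply: IH].
Qed.

Lemma short_exact_lid E :
  exists N (b : {linear E -> N}), short_exact (lid E) b /\ forall x : N, x = 0.
Proof.
exists 'rV[R]_0, (lzero _ _); split; last by move=> x; apply/rowP; case.
split=> //; first by move=> y; split=> // _; exists y.
by move=> x; exists 0; apply/rowP; case.
Qed.

Lemma Add_zero s E : (forall x : E, x = 0) -> Add J s E.
Proof.
move=> E0; exists unit, (lzero _ _), (lzero _ _) => x.
by rewrite [RHS]E0.
Qed.

Lemma copresented_zero i s M : (forall x : M, x = 0) -> copresented i s M.
Proof.
elim: i s M => // i IH s M M0; have [N [b [ab N0]]] := short_exact_lid M.
exists M, N, (lid M), b; split=> //; last exact: IH.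
- exact: injective_zero.
- exact: Add_zero.
Qed.

Lemma copresented_injective i s E : injective_mod E -> Add J s E -> copresented i s E.
Proof.
case: i => // i iE AE; have [N [b [ab N0]]] := short_exact_lid E.
by exists E, N, (lid E), b; split=> //; exact: copresented_zero.
Qed.

(** Horseshoe lemma: the first term for B is the product of those for A and C, and
    the cokernels form a short exact sequence again. *)
Lemma copresented_ext i s A B C (f : {linear A -> B}) (g : {linear B -> C}) :
  short_exact f g -> copresented i s A -> copresented i s C -> copresented i s B.
Proof.
elim: i s A B C f g => // i IH s A B C f g [fi fgE go].
move=> [EA [NA [a [pa [iEA AEA [ai aE pao] RA]]]]].
move=> [EC [NC [c [pc [iEC AEC [ci cE pco] RC]]]]].
have [al alE] := iEA _ _ f a fi.
pose b := lpair al (lcomp c g).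
have bi : injective b.
  apply: linear_injective => x e.
  have [e1 e2] : al x = 0 /\ c (g x) = 0 by move: e; rewrite /b /= /lpairf => -[-> ->].
  have /fgE[y yx] := injective_eq0 ci e2.
  by rewrite -yx (_ : y = 0) ?linear0 //; apply: (injective_eq0 ai); rewrite -alE yx.
have [NB [pb [pbo bE]]] := cokernel_exists b.
have [|nA nAE] := @factor_through_onto _ _ _ _ pa (lcomp pb (linl EA EC)) pao.
  move=> x /aE[y <-]; apply/bE; exists (f y).
  by rewrite /b /= /lpairf /= alE (exact_comp0 y fgE) linear0.
have [|nB nBE] := @factor_through_onto _ _ _ _ pb (lcomp pc (lsnd EA EC)) pbo.
  by move=> x /bE[y <-]; rewrite /= (exact_comp0 (g y) cE).
exists (EA * EC)%type, NB, b, pb; split=> //.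
- exact: injective_prod.
- exact: Add_prod.
- apply: (IH _ _ _ _ nA nB) RA RC; split.
  + apply: linear_injective => x; have [e <-] := pao x; rewrite nAE => /bE[y].
    rewrite /b /= /lpairf /= => -[ye /(injective_eq0 ci)/fgE[z zy]].
    by apply/aE; exists z; rewrite -alE zy.
  + move=> y; split=> [|[x <-]].
      have [[e e'] <-] := pbo y; rewrite nBE /= => /cE[z ze].
      have [x xz] := go z; exists (pa (e - al x)); rewrite nAE /=.
      apply/subr0_eq; rewrite -linearB; apply/bE; exists (- x).
      by rewrite linearN /b /= /lpairf /= xz ze; congr (_, _); rewrite ?sub0r // addrC addKr.
    by have [e <-] := pao x; rewrite nAE nBE /= linear0.
  + by move=> x; have [e <-] := pco x; exists (pb (0, e)); rewrite nBE.
Qed.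

(** Embed M in the first term E for P; then E/M is an extension of E/P by N. *)
Lemma copresented_ker i s M P N (f : {linear M -> P}) (g : {linear P -> N}) :
  short_exact f g -> copresented i.+1 s P -> copresented i s.+1 N -> copresented i.+1 s M.
Proof.
move=> [fi fgE go] [E [NP [a [b [iE AE [ai aE bo] RP]]]]] RN.
have [M1 [p [po pE]]] := cokernel_exists (lcomp a f).
exists E, M1, (lcomp a f), p; split=> //.
  by split=> // x y /= /ai/fi.
have [|n nE] := @factor_through_onto _ _ _ _ g (lcomp p a) go.
  by move=> x /fgE[y <-]; apply/pE; exists y.
have [|m mE] := @factor_through_onto _ _ _ _ p b po.
  by move=> x /pE[y <-]; apply: exact_comp0 aE.
apply: (copresented_ext (f := n) (g := m)) RN RP; split.
- apply: linear_injective => x; have [y <-] := go x; rewrite nE => /pE[z /ai zy].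
  by apply/fgE; exists z.
- move=> y; split=> [|[x <-]].
    have [e <-] := po y; rewrite mE => /aE[x <-].
    by exists (g x); rewrite nE.
  by have [z <-] := go x; rewrite nE mE; apply: exact_comp0 aE.
- by move=> x; have [e <-] := bo x; exists (p e); rewrite mE.
Qed.

Lemma min_inj_resolution_tail M (I : min_inj_resolution M) :
  exists K (e : {linear I 0%N -> K}) (I' : min_inj_resolution K),
    short_exact (ir_aug I) e /\ forall l, I' l = I l.+1.
Proof.
have [K [k [ki kE]]] := kernel_exists (ir_d I 1%N).
have [|e eE] := @lift_through_inj _ _ _ _ k (ir_d I 0%N) ki.
  by move=> x; apply/kE; apply/(ir_exact I 0%N); exists x.
have e0 x : e x = 0 <-> ir_d I 0%N x = 0.
  by rewrite -eE; split=> [->|]; [rewrite linear0 | apply: injective_eq0].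
have kes : essential k.
  apply/essentialP => y y0; have /essentialP : essential (ir_d I 0%N) by exact: ir_min.
  by move=> /(_ y y0)[r [x [xE nz]]]; exists r, (e x); rewrite eE.
pose I' := @MinInjResolution R K (fun j => I j.+1) k (fun j => ir_d I j.+1) ki kE
  (fun j => ir_exact I j.+1) (fun j => @ir_injective _ _ I j.+1) kes
  (fun j => @ir_min _ _ I j.+1).
exists K, e, I'; split=> //; split=> [x y|y|y].
- exact: ir_aug_inj.
- by rewrite e0; exact: ir_exact0.
- have /kE/(ir_exact I 0%N)[x xE] : exists x, k x = k y by exists y.
  by exists x; apply: (ki); rewrite eE.
Qed.

Lemma min_res_copresented i s M (I : min_inj_resolution M) :
  (forall l, (l < i)%N -> Add J (s + l) (I l)) -> copresented i s M.
Proof.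
elim: i s M I => // i IH s M I AI; have [K [e [I' [ab I'E]]]] := min_inj_resolution_tail I.
exists (I 0%N), K, (ir_aug I), e; split=> //.
- exact: (@ir_injective _ _ I 0%N).
- by rewrite -[s]addn0; apply: AI.
- by apply: (IH _ _ I') => l li; rewrite I'E addSnnS; apply: AI.
Qed.

(** The first term E of any injective resolution contains I_0 as a summand, with
    complement H say, and the first cosyzygy of the minimal resolution is the
    kernel of a map from E/M onto H; [copresented_ker] makes the induction go
    on. *)
Lemma copresented_min_res i s M (I : min_inj_resolution M) : copresented i s M ->
  forall l, (l < i)%N -> Add J (s + l) (I l).
Proof.
elim: i s M I => // i IH s M I [E [N [a [b [iE AE [ai aE bo] RN]]]]].
have [K [e [I' [[_ eE eo] I'E]]]] := min_inj_resolution_tail I.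
have iI : injective_mod (I 0%N) by exact: (@ir_injective _ _ I 0%N).
have [|th thE] := iE _ _ (ir_aug I) a; first by move=> x y; exact: ir_aug_inj.
have thi : injective th.
  apply: linear_injective => y ty; apply/eqP; apply: contrapT => /negP y0.
  have /essentialP : essential (ir_aug I) by exact: ir_min0.
  move=> /(_ y y0)[r [x [xE /negP]]]; apply.
  rewrite (_ : x = 0) ?linear0 //; apply: (injective_eq0 ai).
  by rewrite -thE -xE linearZ /= ty scaler0.
have [rho rhoE] := iI _ _ th (lid _) thi.
have I0E : retract (I 0%N) E by exists th, rho.
case=> [_|l li]; first by rewrite addn0; exact: Add_retract AE.
rewrite -I'E -addSnnS; apply: (IH _ K) => //.
case: i {IH li} RN => // i RN.
(* the complement of the first term in E *)
have [H [j [ji jE]]] := kernel_exists rho.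
have [|q qE] := @lift_through_inj _ _ _ _ j (lsub (lid E) (lcomp th rho)) ji.
  by move=> x; apply/jE; rewrite /= linearB /= rhoE subrr.
have qj x : q (j x) = x.
  by apply: ji; rewrite qE /= (exact_comp0 x jE) linear0 subr0.
have HE : retract H E by exists j, q.
have iH : injective_mod H by apply: injective_mod_retract iE qj.
have [|n nE] := @factor_through_onto _ _ _ _ e (lcomp b th) eo.
  by move=> x /eE[y <-]; rewrite /= thE; apply: exact_comp0 aE.
have [|m mE] := @factor_through_onto _ _ _ _ b q bo.
  move=> x /aE[y <-]; apply: ji; rewrite qE /= linear0 -thE rhoE subrr //.
apply: (copresented_ker (f := n) (g := m)) RN _.
  split.
  - apply: linear_injective => x; have [y <-] := eo x; rewrite nE => /aE[z zE].
    by apply/eE; exists z; apply: thi; rewrite thE.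
  - move=> y; split=> [|[z <-]].
      have [x <-] := bo y; rewrite mE => qx; exists (e (rho x)); rewrite nE /=; congr (b _).
      by have := qE x; rewrite qx linear0 /= => /esym/subr0_eq.
    have [t <-] := eo z; rewrite nE mE; apply: ji.
    by rewrite qE /= rhoE subrr linear0.
  - by move=> x; exists (b (j x)); rewrite mE qj.
apply: copresented_injective iH _; apply: Add_mono; apply: Add_mono.
exact: Add_retract AE.
Qed.
End Coresolutions.

Section ClassR.
Variables (R : pzRingType) (J : min_inj_resolution (R^o : lmodType R)).
Implicit Types M N P : lmodType R.

Lemma copresented_regular i s : copresented J i s R^o.
Proof.
elim: s => [|s IH]; last exact: copresented_mono.
by apply: (min_res_copresented (I := J)) => l _; exact: Add_self.
Qed.

(** The two minimal resolutions chosen inside [class_R] are replaced by the fixed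
    resolution J of the ring. *)
Lemma class_RP i M : class_R i M <-> fin_gen M /\ copresented J i 0 M.
Proof.
split=> [[fM [I [J' IJ]]]|[fM RM]]; split=> //.
  apply: (min_res_copresented (I := I)) => l li; have [X /isom_to_summandP IX] := IJ l li.
  apply: (Add_trans (J' := J')); last by exists X.
  by move=> k; exact: (copresented_min_res J' (copresented_regular k.+1 0)).
exists (some_min_inj_resolution M), J => l li.
have [X EX] := copresented_min_res (some_min_inj_resolution M) RM li.
by exists X; apply/isom_to_summandP.
Qed.

Lemma copresented_row i s k : copresented J i s 'rV[R]_k.
Proof.
elim: k => [|k IH]; first by apply: copresented_zero => x; apply/rowP; case.
have [|f fE] := @linear_exists R R^o 'rV[R]_k.+1
    (fun x => \row_j (if j == ord0 then x else 0 : R)).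
  move=> a x y; apply/rowP=> j; rewrite !mxE; case: ifP => // _.
  by rewrite mulr0 addr0.
have [|g gE] := @linear_exists R 'rV[R]_k.+1 'rV[R]_k (fun r => \row_j r 0 (lift ord0 j)).
  by move=> a x y; apply/rowP=> j; rewrite !mxE.
apply: (copresented_ext (f := f) (g := g)) (copresented_regular i s) IH; split.
- by move=> x y; rewrite !fE => /rowP/(_ ord0); rewrite !mxE.
- move=> r; rewrite gE; split=> [/rowP r0|[x <-]].
    exists (r 0 ord0); rewrite fE; apply/rowP=> j; rewrite !mxE.
    case: (unliftP ord0 j) => [l ->|-> //].
    by rewrite eq_sym (negbTE (neq_lift _ _)); have := r0 l; rewrite !mxE => ->.
  by apply/rowP=> j; rewrite fE !mxE.
- move=> r; exists (\row_j (if unlift ord0 j is Some l then r 0 l else 0)).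
  by apply/rowP=> j; rewrite gE !mxE liftK.
Qed.

(** By induction on i, as P is the kernel of a map from a free module onto a
    projective complement. *)
Lemma copresented_projective i s P : fin_gen P -> projective P -> copresented J i s P.
Proof.
elim: i s P => // i IH s P /fin_genP[k [x xo]] pP.
have [f fE] := pP _ _ (lcomb x) (lid P) xo.
have [K [j [ji jE]]] := kernel_exists (lcomb x).
have [|g gE] := @lift_through_inj _ _ _ _ j (lsub (lid _) (lcomp f (lcomb x))) ji.
  by move=> r; apply/jE; rewrite linearB /= (fE (lcomb x r)) subrr.
have gj r : g (j r) = r.
  by apply: ji; rewrite gE /= (exact_comp0 r jE) linear0 subr0.
apply: (copresented_ker (f := f) (g := g)); last 1 first.
- apply: IH; last by apply: projective_retract gj; exact: row_projective.
  by apply: (fin_gen_onto (f := g)); [move=> r; exists (j r) | exact: fin_gen_row].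
- split.
  + by move=> u v e; have := fE u; rewrite e fE.
  + move=> r; split=> [gr|[y <-]].
      by exists (lcomb x r); have := gE r; rewrite gr linear0 => /esym/subr0_eq.
    by apply: ji; rewrite gE linear0 /= fE subrr.
  + by move=> r; exists (j r).
- exact: copresented_row.
Qed.

Lemma syz_copresented i M : syz i M -> copresented J i 0 M.
Proof.
elim: i M => // i IH M [fM [P [N [a [b [fP pP ab /IH RN]]]]]].
apply: (copresented_ker ab); first exact: copresented_projective.
exact: copresented_mono.
Qed.
End ClassR.

From mathcomp Require Import freeg.

(** * Tensor products and flatness *)

Section FreeAbelian.
Variables (X : choiceType) (V : zmodType).
Local Notation free := {freeg X / int}.

Lemma additive_fun_sum (A B : zmodType) (f : A -> B) (T : Type) (s : seq T) (F : T -> A) :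
  additive_fun f ->
  f (\sum_(i <- s) F i) = \sum_(i <- s) f (F i).
Proof.
move=> af; elim: s => [|x s IH]; first by rewrite !big_nil additive_fun0.
by rewrite !big_cons additive_funD // IH.
Qed.

Lemma additive_funN (A B : zmodType) (f : A -> B) x : additive_fun f -> f (- x) = - f x.
Proof. by move=> af; rewrite -sub0r af additive_fun0 // sub0r. Qed.

Lemma additive_funMz (A B : zmodType) (f : A -> B) x (n : int) :
  additive_fun f -> f (x *~ n) = f x *~ n.
Proof.
move=> af; have fn m : f (x *+ m) = f x *+ m.
  by elim: m => [|m IH]; rewrite ?mulr0n ?additive_fun0 // !mulrS additive_funD // IH.
by case: n => n; rewrite ?NegzE ?mulrNz ?additive_funN -?pmulrn ?fn.
Qed.

Lemma freeg_lift_exists (h : X -> V) :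
  exists2 f : free -> V, additive_fun f & forall x, f << x >> = h x.
Proof.
exists (fglift (h : X -> zmodule V)) => [x y|x].
  exact: (lift_is_additive (h : X -> zmodule V)).
by rewrite liftU scale1r.
Qed.

Lemma freeg_eq0 (f : free -> V) (w : free) : additive_fun f ->
  (forall z, z \in dom w -> f << z >> = 0) -> f w = 0.
Proof.
move=> af f0; rewrite -(freeg_sumE w) additive_fun_sum // big1_seq // => z /andP[_ zw].
have -> : << coeff z w *g z >> = << z >> *~ coeff z w :> free.
  by rewrite freeg_mulz intz.
by rewrite additive_funMz // f0 // mul0rz.
Qed.
End FreeAbelian.

Section Tensor.
Variable R : pzRingType.
Implicit Types A B : lmodType R^c.
Implicit Types C D F M N P : lmodType R.

Local Notation free A F := {freeg (A * F)%type / int}.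

Definition tensor_pi A F (w : free A F) : tensor A F :=
  \pi_(Quotient.quot (@tensor_ker R A F)) w.

Lemma tensor_pi_additive A F : additive_fun (@tensor_pi A F).
Proof. by move=> x y; exact: (raddfB (\pi_(Quotient.quot (@tensor_ker R A F)))). Qed.

Lemma tensor_pi_eq0 A F (w : free A F) : tensor_pi w = 0 <-> tensor_rel w.
Proof.
rewrite -(additive_fun0 (@tensor_pi_additive A F)) -[w in tensor_rel w]subr0.
have E := Quotient.idealrBE (@tensor_ker R A F) w 0.
split=> [e|r].
  by apply/asboolP; change (w - 0 \in @tensor_ker R A F); rewrite E; apply/eqP.
by apply/eqP; rewrite /tensor_pi -E; apply/asboolP.
Qed.

Lemma tensor_pi_onto A F (x : tensor A F) : exists w, tensor_pi w = x.
Proof. by exists (repr (x : Quotient.quot (@tensor_ker R A F))); exact: reprK. Qed.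

Lemma pureE A F (a : A) (x : F) : pure_tensor a x = tensor_pi << (a, x) >>.
Proof. by []. Qed.

Lemma pureDl A F a b (x : F) :
  pure_tensor (a + b : A) x = pure_tensor a x + pure_tensor b x.
Proof.
apply/eqP; rewrite -subr_eq0 opprD addrA !pureE -!tensor_pi_additive; apply/eqP/tensor_pi_eq0.
exact: tensor_rel_Dl.
Qed.
Lemma pureDr A F (a : A) (x y : F) :
  pure_tensor a (x + y) = pure_tensor a x + pure_tensor a y.
Proof.
apply/eqP; rewrite -subr_eq0 opprD addrA !pureE -!tensor_pi_additive; apply/eqP/tensor_pi_eq0.
exact: tensor_rel_Dr.
Qed.
Lemma pureZ A F (a : A) (r : R) (x : F) :
  pure_tensor ((r : R^c) *: a) x = pure_tensor a (r *: x).
Proof.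
by apply/subr0_eq; rewrite !pureE -tensor_pi_additive; apply/tensor_pi_eq0/tensor_rel_bal.
Qed.
Lemma pure0l A F (x : F) : pure_tensor (0 : A) x = 0.
Proof. by apply: (addrI (pure_tensor 0 x)); rewrite -pureDl !addr0. Qed.
Lemma pure0r A F (a : A) : pure_tensor a (0 : F) = 0.
Proof. by apply: (addrI (pure_tensor a 0)); rewrite -pureDr !addr0. Qed.
Lemma pure_sumr A F (a : A) k (x : 'I_k -> F) :
  pure_tensor a (\sum_i x i) = \sum_i pure_tensor a (x i).
Proof. by apply: (big_morph (pure_tensor a)) => [y z|]; [exact: pureDr | exact: pure0r]. Qed.
Lemma pureBl A F a b (x : F) :
  pure_tensor (a - b : A) x = pure_tensor a x - pure_tensor b x.
Proof. by apply/eqP; rewrite eq_sym subr_eq -pureDl subrK. Qed.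

Lemma tensor_map_exists A B F (f : {linear A -> B}) :
  exists2 phi : free A F -> free B F,
    additive_fun phi /\ (forall z, phi << z >> = << (f z.1, z.2) >>) &
  forall w, tensor_rel w -> tensor_rel (phi w).
Proof.
have [phi ap phiE] := freeg_lift_exists (fun z : A * F => << (f z.1, z.2) >> : free B F).
exists phi => // w; elim=> [a b x|a x y|r a x||u v _ ru _ rv].
- by rewrite !ap !phiE /= linearD; exact: tensor_rel_Dl.
- by rewrite !ap !phiE /=; exact: tensor_rel_Dr.
- by rewrite !ap !phiE /= linearZ; exact: tensor_rel_bal.
- by rewrite additive_fun0 //; exact: tensor_rel_0.
- by rewrite ap; exact: tensor_rel_B.
Qed.

(** A relation in B (x) F involves only a finite set t of elements of F. So it
    is killed by the evaluation b (x) x |-> v x . b along any function v that is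
    linear on some submodule C containing t. *)
Lemma tensor_rel_local B F (z : free B F) : tensor_rel z ->
  exists t : seq F, forall C (c : {linear C -> F}) (v : F -> R) (u : {linear C -> R^o})
    (ev : free B F -> B),
    (forall x, x \in t -> exists y, c y = x) -> (forall y, v (c y) = u y) ->
    additive_fun ev -> (forall b x, ev << (b, x) >> = (v x : R^c) *: b) -> ev z = 0.
Proof.
elim=> [a b x|a x y|r a x||u v _ [t IHt] _ [s IHs]].
- by exists [::] => C c v u ev _ _ aev evE; rewrite !aev !evE scalerDr addrAC addrK subrr.
- exists [:: x; y] => C c v u ev tC vE aev evE.
  have [|x' <-] := tC x; first by rewrite !inE eqxx.
  have [|y' <-] := tC y; first by rewrite !inE eqxx orbT.
  rewrite !aev !evE -linearD !vE linearD.
  suff -> : ((u x' + u y' : R^o) : R^c) *: a = (u x' : R^c) *: a + (u y' : R^c) *: a.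
    by rewrite addrAC addrK subrr.
  by rewrite -scalerDl.
- exists [:: x] => C c v u ev tC vE aev evE.
  have [|x' <-] := tC x; first by rewrite !inE eqxx.
  rewrite !aev !evE -linearZ !vE scalerA; apply/eqP; rewrite subr_eq0; apply/eqP.
  by congr (_ *: _); rewrite linearZ.
- by exists [::] => C c v u ev _ _ aev _; exact: additive_fun0.
exists (t ++ s) => C c v' u' ev tC vE aev evE.
by rewrite aev (IHt C c v' u') ?(IHs C c v' u') ?subr0 // => x xs; apply: tC;
  rewrite mem_cat xs ?orbT.
Qed.

(** Take w in A (x) F that dies in B (x) F, and let C contain all the elements of
    F that occur in w and in the relation witnessing its vanishing. On C the
    inclusion is a finite sum of forms l_i times elements x_i of F, so
    w = sum_i l_i(w) (x) x_i, where each l_i(w) in A is 0 because f (l_i(w)) is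
    l_i(f w) = 0 and f is injective. *)
Lemma flat_local F :
  (forall t : seq F, exists C (c : {linear C -> F})
      P (u : {linear C -> P}) (v : {linear P -> F}),
    [/\ injective c, fin_gen C, forall x, x \in t -> exists y, c y = x,
        projective P & forall y, v (u y) = c y]) -> flat F.
Proof.
move=> loc A B f fi; have [phi [ap phiE] phir] := @tensor_map_exists A B F f.
have [s sE] := choice (@tensor_pi_onto A F).
have [g gE] : exists g : tensor A F -> tensor B F,
    forall w, g (tensor_pi w) = tensor_pi (phi w).
  exists (fun x => tensor_pi (phi (s x))) => w; apply/subr0_eq; rewrite -tensor_pi_additive -ap.
  by apply/tensor_pi_eq0/phir/tensor_pi_eq0; rewrite tensor_pi_additive sE subrr.
have ag : additive_fun g.
  move=> x y; have [w <-] := tensor_pi_onto x; have [w' <-] := tensor_pi_onto y.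
  by rewrite -tensor_pi_additive !gE ap tensor_pi_additive.
pose G : {additive tensor A F -> tensor B F} :=
  HB.pack_for {additive tensor A F -> tensor B F} g (GRing.isZmodMorphism.Build _ _ g ag).
exists G => [a x|]; first by rewrite pureE -[LHS]/(g _) gE phiE.
suff g0 x : g x = 0 -> x = 0.
  by move=> x y e; apply/subr0_eq/g0; rewrite ag; apply/eqP; rewrite subr_eq0; apply/eqP.
have [w <-] := tensor_pi_onto x; rewrite gE => /tensor_pi_eq0/tensor_rel_local[t tE].
have [C [c [P [u [v [ci fC tC pP vu]]]]]] := loc (t ++ [seq z.2 | z <- dom w]).
have [k [p [l lE]]] := proj_basis u pP fC.
have [V VE] : exists V : 'I_k -> F -> R, forall i y, V i (c y) = l i y.
  have [V VE] : exists V : 'I_k * F -> R, forall z, forall y, c y = z.2 -> V z = l z.1 y.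
    suff /choice[V VE] : forall z : 'I_k * F, exists r : R, forall y, c y = z.2 -> r = l z.1 y.
      by exists V.
    move=> [i z] /=; have [[y yz]|ny] := pselect (exists y, c y = z).
      by exists (l i y) => y' y'z; rewrite (ci y' y) // yz.
    by exists 0 => y yz; case: ny; exists y.
  by exists (fun i x => V (i, x)) => i y; apply: VE.
have /choice[eA eAE] : forall i, exists e : free A F -> A,
    additive_fun e /\ forall z, e << z >> = (V i z.2 : R^c) *: z.1.
  move=> i.
  have [e ae eE] := freeg_lift_exists (fun z : A * F => (V i z.2 : R^c) *: z.1).
  by exists e.
have /choice[eB eBE] : forall i, exists e : free B F -> B,
    additive_fun e /\ forall z, e << z >> = (V i z.2 : R^c) *: z.1.
  move=> i.
  have [e ae eE] := freeg_lift_exists (fun z : B * F => (V i z.2 : R^c) *: z.1).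
  by exists e.
have eA0 i : eA i w = 0.
  have [aA eAi] := eAE i; have [aB eBi] := eBE i.
  apply: (injective_eq0 fi); transitivity (eB i (phi w)).
    apply: subr0_eq; apply: (@freeg_eq0 _ _ (fun w => f (eA i w) - eB i (phi w))).
      by move=> a b; rewrite aA ap aB linearB; exact: subr_interchange.
    by move=> z _; rewrite eAi phiE eBi linearZ subrr.
  apply: (tE C c (V i) (l i) (eB i) _ (VE i) aB) => [y yt|b y]; last exact: eBi.
  by apply: tC; rewrite mem_cat yt.
have : tensor_pi w - \sum_i pure_tensor (eA i w) (v (p i)) = 0.
  apply: (@freeg_eq0 _ _ (fun w => tensor_pi w - \sum_i pure_tensor (eA i w) (v (p i)))).
    move=> a b; rewrite tensor_pi_additive.
    have -> : \sum_i pure_tensor (eA i (a - b)) (v (p i)) =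
       \sum_i pure_tensor (eA i a) (v (p i)) - \sum_i pure_tensor (eA i b) (v (p i)).
      by rewrite -sumrB; apply: eq_bigr => i _; rewrite (eAE i).1 pureBl.
    exact: subr_interchange.
  move=> [a z] zw; have [|y yz] := tC z.
    by rewrite mem_cat; apply/orP; right; apply/mapP; exists (a, z).
  apply/eqP; rewrite subr_eq0; apply/eqP.
  have cy : c y = \sum_i (l i y : R) *: v (p i).
    by rewrite -vu lE linear_sum; apply: eq_bigr => i _; rewrite linearZ.
  rewrite -pureE -yz [in LHS]cy pure_sumr; apply: eq_bigr => i _.
  by rewrite (eAE i).2 /= VE pureZ.
move/subr0_eq ->; rewrite big1 // => i _; by rewrite eA0 pure0l.
Qed.

Lemma span_sub M (t : seq M) : exists C (c : {linear C -> M}),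
  [/\ injective c, fin_gen C & forall x, x \in t -> exists y, c y = x].
Proof.
have [C [p [c [po ci cp]]]] := image_exists (lcomb (tnth (in_tuple t))).
exists C, c; split=> //.
  by apply: fin_gen_onto po _; exact: fin_gen_row.
move=> x /(nthP 0)[i it <-]; exists (p (unit_row R (Ordinal it))).
by rewrite cp lcomb_unit (tnth_nth 0).
Qed.

Lemma projective_flat P : projective P -> flat P.
Proof.
move=> pP; apply: flat_local => t; have [C [c [ci fC tC]]] := span_sub t.
by exists C, c, P, c, (lid P); split.
Qed.
End Tensor.

(** * Flat dimension of the injective resolution of the ring *)

Section Approximation.
Variables (R : pzRingType) (J : min_inj_resolution (R^o : lmodType R)).
Implicit Types A B C E F K M N P Q : lmodType R.

(** The induction step: compare a left approximation of M with a syzygy sequence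
    of M; see the exact sequence in the proof. *)
Lemma copresented_torsionfree n i M : left_noetherian R^c ->
  (forall j, (1 <= j <= n)%N -> forall L : lmodType R, class_R j L -> class_Omega j L) ->
  (i <= n)%N -> fin_gen M -> copresented J i 0 M -> torsionfree i M.
Proof.
move=> rN RO; elim: i M => // i IH M ni fM RM; split=> //.
have [_ [Q [A [f [g [fQ pQ [fi fgE go] sA]]]]]] : syz i.+1 M.
  by apply/class_OmegaP/RO => //; apply/(class_RP J).
have tl (x : M) : (forall w : dual M, w x = 0) -> x = 0.
  move=> w0; apply: (injective_eq0 fi); apply: proj_torsionless => // w.
  exact: (w0 (dual_map f w)).
have [L [N [a [b [fL pL [ai abE bo] ea]]]]] := left_approx rN fM tl.
exists L, N, a, b; split=> //.
have [h hE] := forms_extend_proj f fM ea pQ.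
have [|m mE] := @factor_through_onto _ _ _ _ b (lcomp g h) bo.
  by move=> x /abE[y <-]; rewrite /= hE; apply: exact_comp0 fgE.
have fN : fin_gen N by exact: fin_gen_onto bo fL.
apply: IH => //; first exact: ltnW.
(* N + Q is an extension of A by L *)
have RNQ : copresented J i 0 (N * Q)%type.
  apply: (copresented_ext (f := lpair b h)
    (g := lsub (lcomp m (lfst N Q)) (lcomp g (lsnd N Q)))).
  - split.
    + apply: linear_injective => x; rewrite /= /lpairf => -[/abE[y <-]].
      by rewrite hE => /(injective_eq0 fi) ->; rewrite linear0.
    + move=> [x q]; rewrite /= /lpairf; split=> [/subr0_eq|[l [<- <-]]].
        have [l <-] := bo x; rewrite mE /= => e.
        have /fgE[z zE] : g (h l - q) = 0 by rewrite linearB /= e subrr.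
        exists (l - a z); rewrite !linearB /= (exact_comp0 z abE) subr0 hE zE.
        by rewrite opprB addrC subrK.
      by rewrite mE subrr.
    + move=> x; have [q <-] := go x; exists (0, - q).
      by rewrite /= !linear0 linearN sub0r opprK.
  - exact: copresented_projective.
  - exact: syz_copresented.
case: i {ni RM sA} RNQ => // i RNQ.
apply: (copresented_ker (f := linl N Q) (g := lsnd N Q)) RNQ _; last first.
  exact: copresented_projective.
split=> [x y|[x q]|q].
- by rewrite /= /lpairf => -[].
- by rewrite /= /lpairf; split=> [->|[y [_ <-]]] //; exists x.
- by exists (0, q).
Qed.

(** M is a directed union of finitely generated submodules in [copresented k s]. *)
Definition loc_copresented k s M := forall t : seq M, exists C (c : {linear C -> M}),
  [/\ injective c, fin_gen C, forall x, x \in t -> exists y, c y = x & copresented J k s C].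

Lemma loc_copresented_injective s E : injective_mod E -> Add J s E -> loc_copresented 1 s E.
Proof.
move=> iE AE t; have [C [c [ci fC tC]]] := span_sub t.
exists C, c; split=> //; have [N [b [bo bE]]] := cokernel_exists c.
by exists E, N, c, b.
Qed.

(** K is the kernel of the free module on the set M. Finitely many elements of K
    have their support in a finite set w of elements of M, which may be enlarged
    to generate one of the submodules C of M; the kernel of the free module on w
    over C is the required submodule of K, by [copresented_ker]. *)
Lemma loc_copresented_syz k s M : left_noetherian R -> loc_copresented k s.+1 M ->
  exists K F (a : {linear K -> F}) (b : {linear F -> M}),
    [/\ projective F, short_exact a b & loc_copresented k.+1 s K].
Proof.
move=> lN loc; have [b bE] := free_extend (@id M); have [d dE] := delta_exists R M.
have bd x : b (d x) = x.
  rewrite (bE _ [:: x]) //; first by rewrite big_seq1 dE eqxx scale1r.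
  by move=> y; rewrite inE dE => /negbTE ->.
have [K [a [ai aE]]] := kernel_exists b.
exists K, (copies M R^o), a, b; split.
- exact: free_projective.
- by split=> // x; exists (d x).
move=> t; have [S SE] := choice (fun x : K => copies_support (a x)).
have [C [c [ci fC tC RC]]] := loc (flatten [seq S x | x <- t]).
have /fin_genP[l [z zo]] := fC.
(* without repetitions, so that ep below is injective *)
pose w := undup (flatten [seq S x | x <- t] ++ [seq c (z j) | j <- enum 'I_l]).
have wC x : x \in w -> exists y, c y = x.
  rewrite mem_undup mem_cat => /orP[/tC //|/mapP[j _ ->]].
  by exists (z j).
have /choice[y yE] : forall i : 'I_(size w), exists y, c y = w`_i.
  by move=> i; apply: wC; exact: mem_nth.
have idx x : x \in w -> exists i : 'I_(size w), w`_i = x.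
  by move=> /(nthP 0)[i it <-]; exists (Ordinal it).
have yo : onto (lcomb y).
  move=> x; have [r <-] := zo x.
  have /choice[e eE] : forall j, exists i : 'I_(size w), w`_i = c (z j).
    move=> j; apply: idx; rewrite mem_undup mem_cat; apply/orP; right.
    by apply: map_f; rewrite mem_enum.
  exists (\sum_j r 0 j *: unit_row R (e j)); rewrite linear_sum.
  apply: eq_bigr => j _; rewrite linearZ; congr (_ *: _).
  by apply: ci; rewrite -eE -yE; congr (c _); exact: lcomb_unit.
pose ep := lcomb (fun i : 'I_(size w) => d w`_i).
have epc (r : 'rV[R]_(size w)) : b (ep r) = c (lcomb y r).
  rewrite /ep /lcomb /= /lcombf !linear_sum; apply: eq_bigr => i _.
  by rewrite !linearZ /= bd yE.
have epj (r : 'rV[R]_(size w)) (j : 'I_(size w)) : (ep r) w`_j = r 0 j.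
  rewrite -[LHS]/(copies_coord R^o w`_j _) /ep /lcomb /= /lcombf linear_sum (bigD1 j) //= big1.
    change (r 0 j * (d w`_j w`_j : R) + 0 = r 0 j).
    by rewrite dE eqxx mulr1 addr0.
  move=> i ij; change (r 0 i * (d w`_i w`_j : R) = 0).
  by rewrite dE nth_uniq ?undup_uniq // eq_sym (negbTE (ij : (i : nat) != j)) mulr0.
have epi : injective ep.
  by move=> r q e; apply/rowP=> j; rewrite -!epj e.
have [H [i [ii iE]]] := kernel_exists (lcomb y).
have [|h hE] := @lift_through_inj _ _ _ _ a (lcomp ep i) ai.
  by move=> x; apply/aE; rewrite /= epc (exact_comp0 x iE) linear0.
exists H, h; split.
- by move=> x x' e; apply/ii/epi; have := hE x; rewrite e hE.
- by apply: (fin_gen_sub (i := i)) => //; exact: fin_gen_row.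
- move=> x xt; pose r : 'rV[R]_(size w) := \row_j (a x) w`_j.
  have epr : ep r = a x.
    have ws0 m : m \notin w -> a x m = 0.
      move=> mw; apply: (SE x).2; apply: contra mw => mS.
      rewrite mem_undup mem_cat; apply/orP; left; apply/flattenP.
      by exists (S x) => //; apply: map_f.
    rewrite [RHS](delta_sum dE (undup_uniq _) ws0) (big_nth 0) big_mkord.
    by apply: eq_bigr => j _; rewrite mxE.
  have /iE[q qE] : lcomb y r = 0.
    by apply: (injective_eq0 ci); rewrite -epc epr; apply: exact_comp0 aE.
  by exists q; apply: ai; rewrite hE /= qE.
- apply: (copresented_ker (f := i) (g := lcomb y)) RC; first by split.
  exact: copresented_row.
Qed.

Definition torsionfree_factors k M := forall A (g : {linear A -> M}), torsionfree k A ->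
  exists P (u : {linear A -> P}) (v : {linear P -> M}), projective P /\ forall x, v (u x) = g x.

(** A 1-torsionfree module embeds in a projective, to which the map extends. *)
Lemma torsionfree_factors_injective E : injective_mod E -> torsionfree_factors 1 E.
Proof.
move=> iE A g [fA [P [N [a [b [fP pP [ai _ _] _ _]]]]]].
by have [v vE] := iE _ _ a g ai; exists P, a, v.
Qed.

(** A map g from A to K extends to h from the left approximation P of A to F, and
    b h induces a map from the cokernel N of A -> P to M. As N is k-torsionfree
    this map factors through a projective, hence lifts to F; subtracting the lift
    from h gives a map P -> K that still extends g. *)
Lemma torsionfree_factors_syz k K F M (a : {linear K -> F}) (b : {linear F -> M}) :
  projective F -> short_exact a b -> torsionfree_factors k M -> torsionfree_factors k.+1 K.
Proof.
move=> pF [ai abE bo] EM A g [fA [P [N [a' [b' [fP pP [a'i a'E b'o] ea tN]]]]]].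
have [h hE] := forms_extend_proj (lcomp a g) fA ea pF; rewrite /= in hE.
have [|m mE] := @factor_through_onto _ _ _ _ b' (lcomp b h) b'o.
  by move=> x /a'E[y <-]; rewrite /= hE; apply: exact_comp0 abE.
have [P' [u [v [pP' vu]]]] := EM _ m tN.
have [v' v'E] := pP' _ _ b v bo.
have [|k' k'E] := @lift_through_inj _ _ _ _ a (lsub h (lcomp v' (lcomp u b'))) ai.
  by move=> x; apply/abE; rewrite /= linearB /= v'E vu mE subrr.
exists P, a', k'; split=> // x; apply: ai.
by rewrite k'E /= hE (exact_comp0 x a'E) !linear0 addr0.
Qed.

Lemma flat_fd_le0 M : flat M -> fd_le M 0.
Proof.
move=> fM; pose X k : lmodType R := if k is _.+1 then 'rV[R]_0 else M.
pose d k : {linear X k.+1 -> X k} := lzero _ _.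
have X0 k (x : X k.+1) : x = 0 by exact: thinmx0.
have e0 : exact (d 0%N) (lid M).
  by move=> y; split=> [e|[x <-] //]; exists 0; exact: (esym e).
have ek k : exact (d k.+1) (d k) by move=> y; split=> // _; exists 0; rewrite (X0 k y).
have Xf k : flat (X k).
  by case: k => [|k] //; apply: projective_flat; exact: row_projective.
exists (@Resolution R (@flat R) M X d (lid M) (fun x => ex_intro _ x erefl) e0 ek Xf).
by move=> [|k] // _ x; exact: X0.
Qed.

Lemma fd_leS M m : fd_le M m -> fd_le M m.+1.
Proof. by move=> [F F0]; exists F => k /ltnW; exact: F0. Qed.

(** Each syzygy trades a shift s for one more level k, until [flat_local] applies
    to the m-th syzygy. *)
Lemma fd_le_loc_copresented m k s M : left_noetherian R ->
  (forall C, fin_gen C -> copresented J (k + m) s C -> torsionfree (k + m) C) ->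
  loc_copresented k (s + m) M -> torsionfree_factors k M -> fd_le M m.
Proof.
move=> lN RT; elim: m k M RT => [|m IH] k M RT loc EM.
  rewrite !addn0 in RT loc.
  have fM : flat M.
    apply: flat_local => t; have [C [c [ci fC tC RC]]] := loc t.
    have [P [u [v [pP vu]]]] := EM _ c (RT _ fC RC).
    by exists C, c, P, u, v; split.
  exact: flat_fd_le0.
rewrite addnS in loc; have [K [F [a [b [pF ab locK]]]]] := loc_copresented_syz lN loc.
have [|r rE] := IH k.+1 K _ locK (torsionfree_factors_syz pF ab EM).
  by move=> C; rewrite addSnnS; exact: RT.
exists (resolution_prepend ab (projective_flat pF) r).
by case=> // j mj x; exact: (rE j).
Qed.
End Approximation.

Lemma class_R_T (R : pzRingType) n : left_noetherian R -> left_noetherian R^c ->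
  (forall i, (1 <= i <= n)%N -> forall M : lmodType R, class_R i M -> class_Omega i M) ->
  forall i, (1 <= i <= n)%N -> forall M : lmodType R, class_R i M -> class_T i M.
Proof.
move=> lN rN RO i /andP[_ ni] M /(class_RP (some_min_inj_resolution R^o))[fM RM].
by apply/class_TP => //; exact: copresented_torsionfree RO ni fM RM.
Qed.

Lemma class_T_Omega (R : pzRingType) i (M : lmodType R) :
  left_noetherian R -> left_noetherian R^c ->
  class_T i M -> class_Omega i M.
Proof. by move=> lN rN /class_TP -/(_ lN rN)/torsionfree_syz sM; apply/class_OmegaP. Qed.

Lemma class_Omega_R (R : pzRingType) i (M : lmodType R) : class_Omega i M -> class_R i M.
Proof.
move=> /class_OmegaP sM; apply/(class_RP (some_min_inj_resolution R^o)).
split; last exact: syz_copresented.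
by case: i sM => // i [].
Qed.

Theorem theorem2p5 (R : pzRingType) (n : nat)
    (leftN : left_noetherian R) (rightN : left_noetherian R^c)
    (n_gt0 : (1 <= n)%N) :
  ((forall i : nat, (1 <= i <= n)%N ->
      forall M : lmodType R, class_R i M <-> class_Omega i M)
   <->
   (forall i : nat, (1 <= i <= n)%N ->
      forall M : lmodType R, class_R i M <-> class_T i M))
  /\
  ((forall i : nat, (1 <= i <= n)%N ->
      forall M : lmodType R, class_R i M <-> class_Omega i M)
   -> Gop R n 1).
Proof.
split; first split=> [RO i ni M|RT i ni M].
- split; last by move/class_T_Omega => /(_ leftN rightN) /(RO i ni M).
  by apply: class_R_T ni M => // j nj L /(RO j nj L).
- split; last exact: class_Omega_R.
  by move=> /(RT i ni M); exact: class_T_Omega.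
move=> RO; pose J := some_min_inj_resolution R^o; exists J => i ni.
rewrite addn1; apply: fd_leS.
have iJ : injective_mod (J i) by exact: ir_injective.
apply: (@fd_le_loc_copresented _ J i 1 0) => //.
- move=> C fC; rewrite add1n => RC; apply: (@copresented_torsionfree _ J n) => // j nj L.
  by move=> /(RO j nj L).
- exact: loc_copresented_injective (Add_self _ _).
- exact: torsionfree_factors_injective.
Qed.
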